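(* Let $(W,S)$ be a Coxeter system with $S$ finite, let $(\hat W,\hat S)$, $z_I$, $A=\hat T\smallsetminus W$, $V$, the polynomials $P_A(x,y)$, $P_{\hat T\smallsetminus A}(x,y)$, and the analogues $c_{w,v}$, $c^{\mathrm{inv}}_{w,v}$ of the Kazhdan-Lusztig and inverse Kazhdan-Lusztig polynomials for $V$ be as defined in the context, and let $\varphi([I,a,b])=az_Ib^{-1}$ for $[I,a,b]\in V$. Then for $w,v\in V$, $$c_{w,v}=P_A(\varphi(w),\varphi(v))\quad\text{and}\quad c^{\mathrm{inv}}_{w,v}=P_{\hat T\smallsetminus A}(\varphi(v),\varphi(w)).$$
   Context: Coxeter notation. For a Coxeter system, $\ell$ is the length function and $\leq_\emptyset$ the Chevalley-Bruhat order. For $I\subseteq S$, $W_I$ is the standard parabolic subgroup generated by $I$, and $W^I=\{x\in W\mid x\leq_\emptyset xs\text{ for all }s\in I\}$ is the set of minimal left coset representatives of $W_I$ in $W$. Ring. $\mathcal R=\mathbb Z[u,u^{-1}]$, with ring involution $a\mapsto\bar a$, $\bar u=u^{-1}$; $\alpha=u-u^{-1}$, so $\bar\alpha=-\alpha$. ''Semi-linear'' means with respect to this involution. The poset $V$. $V=\{[I,a,b]\mid I\subseteq S,\ a\in W^I,\ b\in W\}$ (set of triples). Define $[I,a_1,b_1]\leq_1[J,a_2,b_2]$ if $I\subseteq J$, $a_2\leq_\emptyset a_1$, $b_1\leq_\emptyset b_2$; define $[I,a_1,b_1]\leq_2[J,a_2,b_2]$ if $I\subseteq J$ and $b_1=b_2c$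 for some $c\in W_J$ with $\ell(b_1)=\ell(b_2)+\ell(c)$ and $a_2c\leq_\emptyset a_1$. The partial order $\leq$ on $V$ is the one generated by $\leq_1$ and $\leq_2$ ($v\leq w$ iff there is a finite chain from $v$ to $w$ each step of which is $\leq_1$ or $\leq_2$). The dimension function is $d([I,a,b])=-\ell(a)+\ell(b)+|I|$. Action on $V$. Let $\mathbf W=W\times W$, $\mathbf S=(S\times\{1\})\cup(\{1\}\times S)$. $\mathbf W$ acts on the left on $V$ by: $(1,s).[I,a,b]=[I,a,sb]$; $(s,1).[I,a,b]=[I,sa,b]$ if $sa\in W^I$; and $(s,1).[I,a,b]=[I,a,bt]$ if $a\leq_\emptyset sa$ and $sa=at$ with $t\in I$ (for $s\in S$; exactly one of the last two cases occurs). The polynomials $\tilde b_{w,v}$. $\mathbf H$ is the Iwahori-Hecke algebra of $(\mathbf W,\mathbf S)$: free over $\mathcal R$ on $\tilde T_x$ ($x\in\mathbf W$) with, for $\mathbf s\in\mathbf S$, $\tilde T_{\mathbf s}\tilde T_x=\tilde T_{\mathbf sx}$ if $x\leq_\emptyset\mathbf sx$ and $\tilde T_{\mathbf s}\tilde T_x=\tilde T_{\mathbf sx}+\alpha\tilde T_x$ otherwise. $\mathcal M$ is the free $\mathcal R$-module on $\{\tilde m_v\mid v\in V\}$, an $\mathbf H$-module via $\tilde T_{\mathbf s}.\tilde m_v=\tilde m_{\mathbf s.v}$ if $d(v)<d(\mathbf s.v)$ and $\tilde T_{\mathbf s}.\tilde m_v=\tilde m_{\mathbf s.v}+\alpha\tilde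 m_v$ if $d(\mathbf s.v)<d(v)$. $\tilde{\mathcal M}$ is the completion of $\mathcal M$ consisting of formal (possibly infinite) $\mathcal R$-linear combinations of the $\tilde m_v$. For elements $a,b$ of a Coxeter group, $\tilde R_{a,b}(u)=(-u)^{-\ell(b)+\ell(a)}R_{a,b}(u^2)$ where $R_{a,b}$ are the Kazhdan-Lusztig $R$-polynomials ($R_{a,b}=0$ unless $a\leq_\emptyset b$). Springer's map $\Delta\colon\mathcal M\to\tilde{\mathcal M}$ is the semi-linear map $\Delta(\tilde m_v)=\sum_{w\in V}\tilde b_{w,v}\tilde m_w$ ($\tilde b_{w,v}\in\mathcal R$) uniquely determined by: (a) $\Delta(\tilde T_{\mathbf s}.m)=\tilde T_{\mathbf s}^{-1}.\Delta(m)$ for $\mathbf s\in\mathbf S$, $m\in\mathcal M$; (b) $\tilde b_{[I,a_1,b_1],[J,a_2,1]}=0$ if $I\not\subseteq J$ or $b_1\notin W_J$, and $=(\bar\alpha)^{|J|-|I|}\tilde R_{a_2b_1,a_1}$ otherwise. Kazhdan-Lusztig polynomials for $V$. $c_{w,v}\in\mathbb Z[q]$ ($w,v\in V$) are the polynomials with $c_{w,v}=0$ unless $w\leq v$ such that, setting $\gamma_{w,v}=u^{d(w)-d(v)}c_{w,v}(u^2)$, one has $\gamma_{v,v}=1$, $\gamma_{w,v}\in u^{-1}\mathbb Z[u^{-1}]$ for $w<v$, and $\gamma_{w,v}=\sum_{w\leq z\leq v}\tilde b_{w,z}\overline{\gamma_{z,v}}$. The inverse polynomials $c^{\mathrm{inv}}_{w,v}$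 (zero unless $w\leq v$) are determined by $\sum_{w\leq z\leq v}(-1)^{d(z)-d(w)}c_{w,z}\,c^{\mathrm{inv}}_{z,v}=\delta_{w,v}$. The group $\hat W$. $(\hat W,\hat S)$ is a fixed Coxeter system such that $S\subseteq\hat S$, $W=\hat W_S$ is the standard parabolic subgroup of $\hat W$ generated by $S$, and there is a bijection $\theta\colon S\to\hat S\smallsetminus S$ such that for $r,s\in S$, $r$ and $\theta(s)$ do not commute in $\hat W$ iff $r=s$. Fix an enumeration $S=\{r_1,\dots,r_n\}$ with distinct $r_i$. For $I\subseteq S$ put $z_I=\theta(r_{i_1})\cdots\theta(r_{i_m})\in\hat W$ where $S\smallsetminus I=\{r_{i_1},\dots,r_{i_m}\}$ with $i_1<\cdots<i_m$. Twisted orders. $\hat T$ is the set of reflections of $(\hat W,\hat S)$ and $A=\hat T\smallsetminus W$, so $\hat T\smallsetminus A=\hat T\cap W$. Let $B$ be $A$ or $\hat T\smallsetminus A$. For $x\in\hat W$, $N(x)=\{t\in\hat T\mid tx\leq_\emptyset x\}$ and $l_B(x)=\ell(x)-2|N(x^{-1})\cap B|$. The partial order $\leq_B$ on $\hat W$ is generated by the relations $x\leq_B tx$ for $x\in\hat W$, $t\in\hat T$ with $l_B(x)<l_B(tx)$. Let $\mathcal L_B(x)=\{s\in\hat S\mid sx\leq_B x\}$. The polynomials $R^B_{x,y}\in\mathbb Z[\bar\alpha]$ are the unique family, indexed by $x\leq_B y$ and extended by $R^B_{x,y}=0$ when $x\not\leq_B y$, with $R^B_{1,1}=1$ and, for $x\leq_B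 y$ and $s\in\mathcal L_B(y)$, $R^B_{x,y}=R^B_{sx,sy}$ if $s\in\mathcal L_B(x)$ and $R^B_{x,y}=R^B_{sx,sy}+\bar\alpha R^B_{x,sy}$ if $s\notin\mathcal L_B(x)$. There are unique $p_B(x,y)\in\mathbb Z[u,u^{-1}]$ for $x\leq_B y$ with $p_B(y,y)=1$, $p_B(x,y)\in u^{-1}\mathbb Z[u^{-1}]$ if $x\neq y$, and $p_B(x,y)=\sum_{x\leq_B z\leq_B y}R^B_{x,z}\overline{p_B(z,y)}$. The polynomial $P_B(x,y)\in\mathbb Z[q]$ is defined by $u^{l_B(y)-l_B(x)}p_B(x,y)=P_B(x,y)(u^2)$ for $x\leq_B y$, and $P_B(x,y)=0$ otherwise. *)

(* Defs.v *)
From HB Require Import structures.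
From Stdlib Require Import Relations.
From mathcomp Require Import all_boot all_order all_algebra all_fingroup.
From mathcomp Require Import finmap.
From mathcomp Require Import all_classical.

Set Implicit Arguments.
Unset Strict Implicit.
Unset Printing Implicit Defensive.

Import Order.TTheory GRing.Theory Num.Theory.
Local Open Scope ring_scope.

Lemma sum_supp (I : eqType) (R : nmodType) (A B : seq I) (F : I -> R) :
  uniq A -> uniq B -> (forall i, F i != 0 -> (i \in A) && (i \in B)) ->
  \sum_(i <- A) F i = \sum_(i <- B) F i.
Proof.
move=> uA uB h.
have E X : \sum_(i <- X) F i = \sum_(i <- [seq i <- X | F i != 0]) F i.
  rewrite big_filter [LHS](bigID (fun i => F i != 0)) /= [X in _ + X]big1 ?addr0//.
  by move=> i; rewrite negbK => /eqP.
rewrite (E A) (E B); apply: perm_big; apply: uniq_perm; rewrite ?filter_uniq//.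
move=> i; rewrite !mem_filter; case: (boolP (F i != 0)) => //= /h /andP[-> ->] //.
Qed.

(* Z[u, u^-1]: the finitely supported families of integers indexed by the
   exponents of u, with the convolution product. *)
Record laurent := Laurent { lval : {fsfun int -> int with 0} }.
HB.instance Definition _ := [isNew for lval].
HB.instance Definition _ := [Choice of laurent by <:].

Definition lcoef (f : laurent) (k : int) : int := lval f k.
Definition lsupp (f : laurent) : {fset int} := finsupp (lval f).

Section LaurentRing.
Implicit Types f g h : laurent.

Definition lmk (D : {fset int}) (F : int -> int) : laurent :=
  Laurent [fsfun k in D => F k].

Lemma laurentP f g : lcoef f =1 lcoef g -> f = g.
Proof. by case: f g => [f] [g] h; congr Laurent; apply/fsfunP. Qed.

Lemma lmkE D F k : (F k != 0 -> k \in D) -> lcoef (lmk D F) k = F k.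
Proof.
rewrite /lcoef /lmk fsfunE /=; case: ifP => // kD h.
by case: (eqVneq (F k) 0) h => [-> //|_ /(_ isT)].
Qed.

Lemma lsuppP f k : (lcoef f k != 0) = (k \in lsupp f).
Proof. by rewrite /lcoef /lsupp mem_finsupp. Qed.

Definition lzero := lmk fset0%fset (fun=> 0).
Definition lone := lmk [fset (0 : int)]%fset (fun k => (k == 0)%:R).
Definition lopp f := lmk (lsupp f) (fun k => - lcoef f k).
Definition ladd f g := lmk (lsupp f `|` lsupp g)%fset (fun k => lcoef f k + lcoef g k).
Definition lmul f g :=
  lmk [fset (i + j)%R | i in lsupp f, j in lsupp g]%fset
      (fun k => \sum_(i <- lsupp f) lcoef f i * lcoef g (k - i)).

Lemma lzeroE k : lcoef lzero k = 0.
Proof. by rewrite lmkE // eqxx. Qed.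

Lemma loneE k : lcoef lone k = (k == 0)%:R.
Proof. by rewrite lmkE // inE; case: (k == 0). Qed.

Lemma loppE f k : lcoef (lopp f) k = - lcoef f k.
Proof. by rewrite lmkE // oppr_eq0 lsuppP. Qed.

Lemma laddE f g k : lcoef (ladd f g) k = lcoef f k + lcoef g k.
Proof.
rewrite lmkE // in_fsetU -!lsuppP; case: (eqVneq (lcoef f k) 0) => //= ->; by rewrite add0r.
Qed.

Lemma lmulE f g k :
  lcoef (lmul f g) k = \sum_(i <- lsupp f) lcoef f i * lcoef g (k - i).
Proof.
rewrite lmkE //; apply: contraNT => kD.
rewrite big1_seq // => i /andP[_ fi].
case: (eqVneq (lcoef g (k - i)) 0) => [->|]; first by rewrite mulr0.
rewrite lsuppP => gi; case/negP: kD; apply/imfset2P.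
by exists i => //; exists (k - i) => //; rewrite addrC subrK.
Qed.

Lemma laddA : associative ladd.
Proof. by move=> f g h; apply: laurentP => k; rewrite !laddE addrA. Qed.
Lemma laddC : commutative ladd.
Proof. by move=> f g; apply: laurentP => k; rewrite !laddE addrC. Qed.
Lemma ladd0 : left_id lzero ladd.
Proof. by move=> f; apply: laurentP => k; rewrite !laddE lzeroE add0r. Qed.
Lemma laddN : left_inverse lzero lopp ladd.
Proof. by move=> f; apply: laurentP => k; rewrite !laddE loppE lzeroE addNr. Qed.

Lemma lmulC : commutative lmul.
Proof.
move=> f g; apply: laurentP => k; rewrite !lmulE.
transitivity (\sum_(i <- [seq k - j | j <- lsupp g]) lcoef f i * lcoef g (k - i)).
  apply: sum_supp; rewrite ?fset_uniq ?map_inj_uniq ?fset_uniq //.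
    by move=> i j /addrI /oppr_inj.
  move=> i; rewrite mulf_eq0 negb_or !lsuppP => /andP[-> gi] /=.
  by apply/mapP; exists (k - i) => //; rewrite opprB addrC subrK.
rewrite big_map; apply: eq_bigr => j _.
rewrite -[RHS]mulrC.
by have -> : k - (k - j) = j by rewrite opprB addrCA subrr addr0.
Qed.

Lemma lmulA : associative lmul.
Proof.
move=> f g h; apply: laurentP => k; rewrite [LHS]lmulE [RHS]lmulE.
transitivity (\sum_(i <- lsupp f) \sum_(m <- lsupp (lmul f g))
    lcoef f i * lcoef g (m - i) * lcoef h (k - m)); last first.
  by rewrite exchange_big; apply: eq_bigr => m _; rewrite /= -mulr_suml -lmulE.
transitivity (\sum_(i <- lsupp f) \sum_(m <- [fset (i + j)%R | i in lsupp f, j in lsupp g]%fset)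
    lcoef f i * lcoef g (m - i) * lcoef h (k - m)); last first.
  rewrite exchange_big [RHS]exchange_big /=.
  under eq_bigr do rewrite -mulr_suml -lmulE.
  under [RHS]eq_bigr do rewrite -mulr_suml -lmulE.
  apply: sum_supp; rewrite ?fset_uniq // => m.
  rewrite mulf_eq0 negb_or => /andP[fgm _]; rewrite -lsuppP fgm andbT.
  apply: contraNT fgm; rewrite /lcoef /lmul /lmk fsfunE /= => /negPf ->.
  by rewrite eqxx.
apply: eq_big_seq => i fi; rewrite lmulE mulr_sumr.
transitivity (\sum_(m <- [seq i + j | j <- lsupp g])
    lcoef f i * lcoef g (m - i) * lcoef h (k - m)).
  rewrite big_map; apply: eq_bigr => j _.
  by rewrite (_ : i + j - i = j) ?mulrA ?opprD ?addrA // addrC addKr.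
apply: sum_supp; rewrite ?fset_uniq ?(map_inj_uniq (@addrI _ i)) ?fset_uniq //.
move=> m; rewrite !mulf_eq0 !negb_or !lsuppP => /andP[/andP[_ gm] _].
have E : m = i + (m - i) by rewrite addrC subrK.
apply/andP; split; first by apply/mapP; exists (m - i).
by apply/imfset2P; exists i => //; exists (m - i).
Qed.

Lemma lmul1 : left_id lone lmul.
Proof.
move=> f; apply: laurentP => k; rewrite lmulE.
rewrite (@sum_supp _ _ _ [:: 0]) ?fset_uniq //.
  by rewrite big_seq1 loneE eqxx mul1r subr0.
move=> i; rewrite mulf_eq0 negb_or -lsuppP loneE inE.
by case: (i == 0) => //=; rewrite eqxx.
Qed.

Lemma lmulD : left_distributive lmul ladd.
Proof.
move=> f g h; apply: laurentP => k; rewrite laddE [lmul f h]lmulC [lmul g h]lmulC.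
rewrite lmulC !lmulE -big_split; apply: eq_bigr => i _ /=.
by rewrite laddE mulrDr.
Qed.

Lemma lone_neq0 : lone != lzero.
Proof.
by apply/eqP => /(congr1 (lcoef^~ 0)); rewrite /= loneE lzeroE.
Qed.

HB.instance Definition _ := GRing.isZmodule.Build laurent laddA laddC ladd0 laddN.
HB.instance Definition _ := GRing.Zmodule_isComNzRing.Build laurent
  lmulA lmulC lmul1 lmulD lone_neq0.

Definition lunit : {pred laurent} := fun f => `[< exists g, g * f = 1 >].
Definition linv f : laurent :=
  if pselect (exists g, g * f = 1) is left e then projT1 (cid e) else f.

Lemma lmulV : {in lunit, left_inverse 1 linv *%R}.
Proof.
move=> f /asboolP e; rewrite /linv; case: pselect => // e'.
exact: projT2 (cid e').
Qed.

Lemma lunitPl f g : g * f = 1 -> lunit f.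
Proof. by move=> e; apply/asboolP; exists g. Qed.

Lemma linv_out : {in [predC lunit], linv =1 id}.
Proof.
move=> f; rewrite inE /= => /negP h; rewrite /linv; case: pselect => // e.
by case: h; apply/asboolP.
Qed.

HB.instance Definition _ := GRing.ComNzRing_hasMulInverse.Build laurent
  lmulV lunitPl linv_out.

End LaurentRing.

Definition lmon (n : int) : laurent := lmk [fset n]%fset (fun k => (k == n)%:R).

Lemma lmonE n k : lcoef (lmon n) k = (k == n)%:R.
Proof. by rewrite lmkE // inE; case: (k == n). Qed.

Definition u : laurent := lmon 1.

Lemma lmonM n f k : lcoef (lmon n * f) k = lcoef f (k - n).
Proof.
rewrite [LHS]lmulE (@sum_supp _ _ _ [:: n]) ?fset_uniq //.
  by rewrite big_seq1 lmonE eqxx mul1r.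
move=> i; rewrite mulf_eq0 negb_or -lsuppP lmonE inE.
by case: (i == n) => //=; rewrite eqxx.
Qed.

Lemma lmonD m n : lmon m * lmon n = lmon (m + n).
Proof. by apply: laurentP => k; rewrite lmonM !lmonE subr_eq [n + m]addrC. Qed.

Lemma u_unit : u \is a GRing.unit.
Proof.
apply/unitrPr; exists (lmon (- 1)); rewrite lmonD subrr.
by apply: laurentP => k; rewrite lmonE.
Qed.

Definition bar (f : laurent) : laurent :=
  lmk [fset - k | k in lsupp f]%fset (fun k => lcoef f (- k)).

Lemma barE f k : lcoef (bar f) k = lcoef f (- k).
Proof.
rewrite lmkE // lsuppP => h; apply/imfsetP; exists (- k) => //=.
by rewrite opprK.
Qed.

Definition alpha : laurent := u - u^-1.

(* f lies in u^-1 Z[u^-1] *)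
Definition in_neg (f : laurent) : Prop := forall k : int, 0 <= k -> lcoef f k = 0.

(* the substitution q |-> x *)
Definition psubst (x : laurent) (p : {poly int}) : laurent :=
  (map_poly intr p).[x].

Section CoxeterDef.
Variables (S : finType) (W : groupType).

(* The congruence on words over S generated by (s t)^(m s t) ~ 1.  A zero entry
   of the Coxeter matrix m stands for infinity and gives no relation. *)
Inductive cox_congr (m : S -> S -> nat) : seq S -> seq S -> Prop :=
| cox_refl v : cox_congr m v v
| cox_sym v w : cox_congr m v w -> cox_congr m w v
| cox_trans v w x : cox_congr m v w -> cox_congr m w x -> cox_congr m v x
| cox_rel v w s t :
    cox_congr m (v ++ flatten (nseq (m s t) [:: s; t]) ++ w) (v ++ w).

(* W is presented by the generators S and the relations (s t)^(m s t) = 1;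
   as m s s = 1, the monoid presentation is also a group presentation. *)
Record coxeter_system := CoxeterSystem {
  gen : S -> W;
  cox_mat : S -> S -> nat;
  cox_mat_sym : forall s t, cox_mat s t = cox_mat t s;
  cox_mat_diag : forall s t, (cox_mat s t == 1%N) = (s == t);
  cox_gen : forall x : W, exists w : seq S, x = (\prod_(s <- w) gen s)%g;
  cox_pres : forall v w : seq S,
    (\prod_(s <- v) gen s)%g = (\prod_(s <- w) gen s)%g <-> cox_congr cox_mat v w
}.

End CoxeterDef.

Section Coxeter.
Variables (S : finType) (W : groupType) (C : coxeter_system S W).
Implicit Types (x y t : W) (s : S) (I J : {set S}) (B : set W).
Local Open Scope group_scope.
Local Notation "s ** x" := (gen C s * x)%g (at level 40, left associativity).

Definition has_word x (n : nat) : bool :=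
  [exists w : n.-tuple S, x == \prod_(s <- w) gen C s].

Lemma has_wordP x : exists n, has_word x n.
Proof.
by have [w ->] := cox_gen C x; exists (size w); apply/existsP; exists (in_tuple w).
Qed.

Definition len x : nat := ex_minn (has_wordP x).

Definition reflections : set W :=
  [set t | exists x s, t = x * gen C s * x^-1].

(* The partial order generated by the relations x <= t x, for t a reflection
   with f x < f (t x). *)
Definition refl_order (f : W -> int) : W -> W -> Prop :=
  clos_refl_trans W
    (fun x y => exists2 t, reflections t & y = t * x /\ (f x < f (t * x)%g)%R).

Definition bruhat : W -> W -> Prop := refl_order (fun x => (len x)%:Z).

Definition parabolic I : set W :=
  [set x | exists2 w : seq S, all (mem I) w & x = \prod_(s <- w) gen C s].

Definition minreps I : {pred W} :=
  fun x => `[< forall s, s \in I -> bruhat x (x * gen C s) >].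

(* The recursion that characterizes the Kazhdan-Lusztig R-polynomials, along left
   descents of y; the polynomial variable 'X is q. *)
Definition is_Rpoly (R : W -> W -> {poly int}) : Prop :=
  [/\ forall x, R x x = 1%R,
      forall x y, ~ bruhat x y -> R x y = 0%R
    & forall x y s, bruhat (s ** y) y ->
        (bruhat (s ** x) x -> R x y = R (s ** x) (s ** y)) /\
        (~ bruhat (s ** x) x ->
           R x y = (('X - 1) * R x (s ** y)
                    + 'X * R (s ** x) (s ** y))%R)].

Definition Rtilde (R : W -> W -> {poly int}) x y : laurent :=
  ((- u) ^ (- (len y)%:Z + (len x)%:Z) * psubst (u ^+ 2) (R x y))%R.

Definition inversions x : set W := [set t | reflections t /\ bruhat (t * x) x].

Definition twlen B x : int :=
  ((len x)%:Z - 2 * (#|` fset_set (inversions x^-1 `&` B)%classic|)%:Z)%R.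

Definition twle B : W -> W -> Prop := refl_order (twlen B).

Definition twinterval B x y : set W := [set z | twle B x z /\ twle B z y].

Definition twdesc B x : set S := [set s | twle B (s ** x) x].

(* Z[bar alpha] is taken as a subset of Z[u, u^-1]. *)
Definition is_twR B (R : W -> W -> laurent) : Prop :=
  [/\ R 1 1 = 1%R,
      forall x y, ~ twle B x y -> R x y = 0%R,
      forall x y, exists p : {poly int}, R x y = psubst (bar alpha) p
    & forall x y s, twle B x y -> twdesc B y s ->
        (twdesc B x s -> R x y = R (s ** x) (s ** y)) /\
        (~ twdesc B x s ->
           R x y = (R (s ** x) (s ** y)
                    + bar alpha * R x (s ** y))%R)].

(* The sum over z is the finitely supported sum of the library, which is 0 by
   convention on an infinite support; the intervals for the two orders used here
   (and those of V below) are finite, so it is the ordinary sum. *)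
Definition is_twp B (R p : W -> W -> laurent) : Prop :=
  [/\ forall y, p y y = 1%R,
      forall x y, twle B x y -> x <> y -> in_neg (p x y)
    & forall x y, twle B x y ->
        p x y = (\sum_(z \in twinterval B x y) R x z * bar (p z y))%R].

Definition is_twKL B (P : W -> W -> {poly int}) : Prop :=
  exists R p : W -> W -> laurent,
    [/\ is_twR B R, is_twp B R p,
        forall x y, twle B x y ->
          (u ^ (twlen B y - twlen B x) * p x y)%R = psubst (u ^+ 2)%R (P x y)
      & forall x y, ~ twle B x y -> P x y = 0%R].

Definition Vtype := {v : {set S} * W * W | v.1.2 \in minreps v.1.1}.

Definition vI (v : Vtype) : {set S} := (val v).1.1.
Definition va (v : Vtype) : W := (val v).1.2.
Definition vb (v : Vtype) : W := (val v).2.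

Lemma vP (v : Vtype) : va v \in minreps (vI v).
Proof. exact: (proj2_sig v). Qed.

Definition mkV I a b (aI : a \in minreps I) : Vtype :=
  exist (fun v : {set S} * W * W => v.1.2 \in minreps v.1.1) (I, a, b) aI.

Definition vle1 (v w : Vtype) : Prop :=
  [/\ vI v \subset vI w, bruhat (va w) (va v) & bruhat (vb v) (vb w)].

Definition vle2 (v w : Vtype) : Prop :=
  vI v \subset vI w /\
  exists c, [/\ parabolic (vI w) c, vb v = vb w * c,
                len (vb v) = (len (vb w) + len c)%N
              & bruhat (va w * c) (va v)].

Definition vle : Vtype -> Vtype -> Prop :=
  clos_refl_trans Vtype (fun v w => vle1 v w \/ vle2 v w).

Definition vinterval (v w : Vtype) : set Vtype := [set z | vle v z /\ vle z w].

Definition vdim (v : Vtype) : int :=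
  (- (len (va v))%:Z + (len (vb v))%:Z + #|vI v|%:Z)%R.

(* inl s stands for (s, 1) and inr s for (1, s).  The defaults v for inl
   are never reached: insubd is used where the constraint holds, and if
   s a is not in W^I then a <= s a and s a = a t for some t in I. *)
Definition vact (x : S + S) (v : Vtype) : Vtype :=
  match x with
  | inr s => mkV (gen C s * vb v) (vP v)
  | inl s =>
      if gen C s * va v \in minreps (vI v) then
        insubd v (vI v, gen C s * va v, vb v)
      else if [pick t in vI v | `[< bruhat (va v) (gen C s * va v) >]
                              && (gen C s * va v == va v * gen C t)] is Some t then
        mkV (vb v * gen C t) (vP v)
      else v
  end.

Local Open Scope ring_scope.

(* A function f : Vtype -> laurent is the formal combination of the basis
   elements m_v with coefficients f v; M consists of those of finite support. *)
Definition in_M (f : Vtype -> laurent) : Prop :=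
  finite_set [set v | f v != 0].

(* T_x . m_v *)
Definition heckeTm (x : S + S) (v : Vtype) : Vtype -> laurent :=
  fun w => (w == vact x v)%:R
           + (if vdim (vact x v) < vdim v then alpha * (w == v)%:R else 0).

(* For each w only v = w and the v with x.v = w contribute. *)
Definition heckeT (x : S + S) (f : Vtype -> laurent) : Vtype -> laurent :=
  fun w => \sum_(v \in [set: Vtype]) f v * heckeTm x v w.

(* T_x^-1 = T_x - alpha, by the quadratic relation T_x^2 = 1 + alpha T_x *)
Definition heckeTinv (x : S + S) (f : Vtype -> laurent) : Vtype -> laurent :=
  fun w => heckeT x f w - alpha * f w.

(* The semi-linear map sending m_v to the sum of the (b w v) m_w *)
Definition semilin (b : Vtype -> Vtype -> laurent) (f : Vtype -> laurent) :
    Vtype -> laurent :=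
  fun w => \sum_(v \in [set: Vtype]) bar (f v) * b w v.

Definition is_btilde (b : Vtype -> Vtype -> laurent) : Prop :=
  exists R : W -> W -> {poly int},
    [/\ is_Rpoly R,
        forall (x : S + S) f, in_M f ->
          semilin b (heckeT x f) =1 heckeTinv x (semilin b f)
      & forall w v, vb v = 1%g ->
          b w v = if (vI w \subset vI v) && `[< parabolic (vI v) (vb w) >]
                  then bar alpha ^+ (#|vI v| - #|vI w|)
                       * Rtilde R (va v * vb w)%g (va w)
                  else 0].

Definition gamma (c : Vtype -> Vtype -> {poly int}) w v : laurent :=
  u ^ (vdim w - vdim v) * psubst (u ^+ 2) (c w v).

Definition is_vKL (b : Vtype -> Vtype -> laurent)
    (c : Vtype -> Vtype -> {poly int}) : Prop :=
  [/\ forall w v, ~ vle w v -> c w v = 0,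
      forall v, gamma c v v = 1,
      forall w v, vle w v -> w <> v -> in_neg (gamma c w v)
    & forall w v, gamma c w v =
        \sum_(z \in vinterval w v) b w z * bar (gamma c z v)].

Definition is_vKLinv (c cinv : Vtype -> Vtype -> {poly int}) : Prop :=
  (forall w v, ~ vle w v -> cinv w v = 0) /\
  forall w v,
    \sum_(z \in vinterval w v) (-1) ^ (vdim z - vdim w) * (c w z * cinv z v)
    = (w == v)%:R.

End Coxeter.

Record hat_extension (S Sh : finType) (W Wh : groupType)
    (C : coxeter_system S W) (Ch : coxeter_system Sh Wh) := HatExtension {
  emb : W -> Wh;
  inc : S -> Sh;
  theta : S -> Sh;
  emb_mul : {morph emb : x y / (x * y)%g};
  emb_inj : injective emb;
  emb_gen : forall s, emb (gen C s) = gen Ch (inc s);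
  inc_inj : injective inc;
  theta_inj : injective theta;
  theta_im : forall s, (s \in codom theta) = (s \notin codom inc);
  theta_comm : forall r s,
    ~ commute (gen Ch (inc r)) (gen Ch (theta s)) <-> r = s
}.

Section Hat.
Variables (S Sh : finType) (W Wh : groupType).
Variables (C : coxeter_system S W) (Ch : coxeter_system Sh Wh).
Variable E : hat_extension C Ch.

Definition Aset : set Wh := [set t | reflections Ch t /\ ~ range (emb E) t].
Definition Acompl : set Wh := [set t | reflections Ch t /\ range (emb E) t].

(* r is the enumeration r_1, ..., r_n of S *)
Definition zI (r : seq S) (I : {set S}) : Wh :=
  (\prod_(s <- r | s \notin I) gen Ch (theta E s))%g.

Definition phi (r : seq S) (v : Vtype C) : Wh :=
  (emb E (va v) * zI r (vI v) * (emb E (vb v))^-1)%g.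

End Hat.

(* Main.v *)
(* Every x in hat W is uniquely a product x' w with x' a minimal left coset
   representative of W and w in W, and l_A (x' w) = len w - len x'.  Since a z_I is
   such a representative for a in W^I, this gives l_A (phi v) = d v - |S|.  Following
   the edges of <=_A upwards from phi v, one deletes a letter of z_I or of a, or
   raises b; hence phi is an isomorphism of V onto an up-closed subset of <=_A.

   The rows of b and of R^A obey the same recursion under left multiplication by S,
   which reduces the comparison to the rows [I, 1, b]; there the recursion of R^A
   under the letters of z_I, and that of b under the right copy of S, reduce both to
   I = S, i.e. to W itself.  The transpose of R^(T \ A) and the sign-twisted
   conjugate of R^A obey the same recursion as R^A, hence also restrict to b; the
   latter says that conjugating b only introduces signs.

   The c_{w,v} then agree with P_A because both solve the same bar-invariance
   problem.  For the inverse polynomials, the product of the P_{T \ A}-matrix with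
   the sign-twisted P_A-matrix of an interval is bar-invariant and unitriangular
   with negative powers of u off the diagonal, so it is the identity. *)

From Stdlib Require Import Relations.
Require Import Defs.
From mathcomp Require Import all_boot all_order all_algebra all_fingroup all_field.
From mathcomp Require Import finmap.
From mathcomp Require Import all_classical.
From mathcomp Require Import zify ring.

Set Implicit Arguments.
Unset Strict Implicit.
Unset Printing Implicit Defensive.

Import Order.TTheory GRing.Theory Num.Theory.

(** * Words, reflections and the length function *)

Lemma card_fset_set_seq (T : choiceType) (A : set T) (r : seq T) :
  uniq r -> (forall x, A x <-> x \in r) -> #|` fset_set A| = size r.
Proof.
move=> ur h; rewrite -[in RHS](undup_id ur) -card_fseq -(set_fsetK [fset y in r]%fset).
by congr (#|` fset_set _|); apply/predeqP => x /=; rewrite inE; exact: h.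
Qed.

Section Reflections.
Variables (S : finType) (W : groupType) (C : coxeter_system S W).
Implicit Types (x y t : W) (s : S) (v w : seq S).
Local Open Scope group_scope.
Local Notation g := (gen C).
Local Notation refl := (reflections C).

Definition wprod w : W := \prod_(s <- w) g s.

Lemma wprod_nil : wprod [::] = 1.
Proof. by rewrite /wprod big_nil. Qed.

Lemma wprod_cons s w : wprod (s :: w) = g s * wprod w.
Proof. by rewrite /wprod big_cons. Qed.

Lemma wprod_cat v w : wprod (v ++ w) = wprod v * wprod w.
Proof. by rewrite /wprod big_cat. Qed.

Lemma wprod_congr v w : cox_congr (cox_mat C) v w -> wprod v = wprod w.
Proof. by move/(cox_pres C). Qed.

Lemma gen_sq s : g s * g s = 1.
Proof.
have := wprod_congr (cox_rel (cox_mat C) [::] [::] s s).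
have /eqP -> : cox_mat C s s == 1%N by rewrite cox_mat_diag.
by rewrite /= !wprod_cons wprod_nil mulg1.
Qed.

Lemma genV s : (g s)^-1 = g s.
Proof. by apply: (mulgI (g s)); rewrite mulgV gen_sq. Qed.

Lemma genK s : involutive (mulg (g s)).
Proof. by move=> x; rewrite mulgA gen_sq mul1g. Qed.

Lemma mulg_genK s x : x * g s * g s = x.
Proof. by rewrite -mulgA gen_sq mulg1. Qed.

Lemma reflP t : refl t -> t * t = 1.
Proof.
by move=> [x [s ->]]; rewrite -!mulgA mulKg (mulgA (g s)) gen_sq mul1g mulgV.
Qed.

Lemma reflV t : refl t -> t^-1 = t.
Proof. by move=> /reflP h; apply: (mulgI t); rewrite mulgV h. Qed.

Lemma refl_gen s : refl (g s).
Proof. by exists 1, s; rewrite mul1g invg1 mulg1. Qed.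

Lemma reflJ x t : refl t -> refl (x * t * x^-1).
Proof. by move=> [y [s ->]]; exists (x * y), s; rewrite invgM !mulgA. Qed.

Lemma reflJV x t : refl t -> refl (x^-1 * t * x).
Proof. by move=> h; rewrite -{2}(invgK x); apply: reflJ. Qed.

Fixpoint refls w : seq W :=
  if w is s :: w' then g s :: [seq g s * t * g s | t <- refls w'] else [::].

Lemma size_refls w : size (refls w) = size w.
Proof. by elim: w => //= s w <-; rewrite size_map. Qed.

Lemma refls_cat v w :
  refls (v ++ w) = refls v ++ [seq wprod v * t * (wprod v)^-1 | t <- refls w].
Proof.
elim: v => [|s v IH] /=.
  by rewrite wprod_nil -[LHS]map_id; apply: eq_map => t; rewrite mul1g invg1 mulg1.
rewrite IH map_cat -map_comp; congr (_ :: _ ++ _).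
by apply: eq_map => t /=; rewrite wprod_cons invgM genV !mulgA.
Qed.

Lemma refls_refl w t : t \in refls w -> refl t.
Proof.
elim: w t => //= s w IH t; rewrite inE => /predU1P[->|/mapP[t' /IH h ->]].
  exact: refl_gen.
by rewrite -{2}(genV s); apply: reflJ.
Qed.

Lemma count_conj x t (r : seq W) :
  count_mem t [seq x * t' * x^-1 | t' <- r] = count_mem (x^-1 * t * x) r.
Proof.
rewrite count_map; apply: eq_count => t' /=.
by apply/eqP/eqP => [<-|->]; rewrite !mulgA ?mulVg ?mul1g ?mulgKV ?mulgV ?mulgK // mul1g.
Qed.

Definition rpar w t := odd (count_mem t (refls w)).

Lemma rpar_cat v w t :
  rpar (v ++ w) t = rpar v t (+) rpar w ((wprod v)^-1 * t * wprod v).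
Proof. by rewrite /rpar refls_cat count_cat oddD count_conj. Qed.

Lemma refls_alt s s' m :
  refls (flatten (nseq m [:: s; s'])) =
  [seq (g s * g s') ^+ i * g s | i <- iota 0 m.*2].
Proof.
elim: m => //= m ->; rewrite expg0 mul1g expg1; congr [:: _, _ & _].
rewrite -[iota 2 _]/(iota (2 + 0) _) iotaDl -!map_comp; apply: eq_map => i /=.
by rewrite -[(2 + i)%N]/(i.+2) (expgS _ i.+1) expgSr !mulgA.
Qed.

Lemma wprod_alt s s' m : wprod (flatten (nseq m [:: s; s'])) = (g s * g s') ^+ m.
Proof. by elim: m => [|m IH]; rewrite ?wprod_nil //= !wprod_cons IH mulgA -expgS. Qed.

Lemma gen_rel s s' : (g s * g s') ^+ cox_mat C s s' = 1.
Proof.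
have := wprod_congr (cox_rel (cox_mat C) [::] [::] s s').
by rewrite cats0 /= wprod_alt wprod_nil.
Qed.

Lemma rpar_congr v w : cox_congr (cox_mat C) v w -> rpar v =1 rpar w.
Proof.
elim=> {v w}.
- by [].
- by move=> v w _ h t; rewrite h.
- by move=> v w x _ h _ k t; rewrite h k.
move=> v w s s' t; rewrite !rpar_cat; congr (_ (+) _).
rewrite wprod_alt gen_rel invg1 mulg1 mul1g.
suff -> : rpar (flatten (nseq (cox_mat C s s') [:: s; s'])) ((wprod v)^-1 * t * wprod v)
          = false by [].
rewrite /rpar refls_alt -addnn iotaD map_cat count_cat add0n.
have -> : iota (cox_mat C s s') (cox_mat C s s') =
          map (addn (cox_mat C s s')) (iota 0 (cox_mat C s s')) by rewrite -iotaDl addn0.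
rewrite -map_comp.
set r := [seq _ | i <- _]; set r' := [seq _ | i <- _].
have -> : r' = r by apply: eq_map => i /=; rewrite expgnDr gen_rel mul1g.
by rewrite addnn odd_double.
Qed.

Lemma rword_ex x : exists w, x = wprod w /\ size w = len C x.
Proof.
rewrite /len; case: ex_minnP => n /existsP[w /eqP ->] _.
by exists w; split=> //; rewrite size_tuple.
Qed.

Definition rword x : seq S := projT1 (cid (rword_ex x)).

Lemma rwordE x : wprod (rword x) = x.
Proof. by rewrite /rword; case: cid => w [/= <-]. Qed.

Lemma size_rword x : size (rword x) = len C x.
Proof. by rewrite /rword; case: cid => w [/= _]. Qed.

Lemma len_wprod w : len C (wprod w) <= size w.
Proof.
rewrite /len; case: ex_minnP => n _; apply.
by apply/existsP; exists (in_tuple w).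
Qed.

(* The parity of the number of times [t] occurs among the reflections read off
   an expression of [x]; it does not depend on the expression because the
   reflections of a braid relation come in equal pairs. *)
Definition invb x t := rpar (rword x) t.

Lemma invb_wprod w t : invb (wprod w) t = rpar w t.
Proof. by apply: rpar_congr; apply/(cox_pres C); rewrite -!/(wprod _) rwordE. Qed.

Lemma invbM x y t : invb (x * y) t = invb x t (+) invb y (x^-1 * t * x).
Proof. by rewrite -{1}(rwordE x) -{1}(rwordE y) -wprod_cat invb_wprod rpar_cat rwordE. Qed.

Lemma invb1 t : invb 1 t = false.
Proof. by rewrite -wprod_nil invb_wprod. Qed.

Lemma invb_gen s t : invb (g s) t = (t == g s).
Proof.
rewrite -[g s]mulg1 -wprod_nil -wprod_cons invb_wprod /rpar /= addn0.
by rewrite wprod_cons wprod_nil mulg1 eq_sym; case: (_ == _).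
Qed.

Lemma invbV x t : invb x^-1 t = invb x (x * t * x^-1).
Proof.
have := invbM x x^-1 (x * t * x^-1); rewrite mulgV invb1 !mulgA mulVg mul1g mulgKV.
by case: (invb x _); case: (invb _ _).
Qed.

Lemma invb_refl x t : invb x t -> refl t.
Proof.
rewrite /invb /rpar => h; apply: (@refls_refl (rword x)).
by rewrite -has_pred1 has_count; case: (count _ _) h.
Qed.

Lemma invb_self t : refl t -> invb t t.
Proof.
move=> [x [s et]]; rewrite {1}et.
have e1 : x^-1 * t * x = g s by rewrite et !mulgA mulVg mul1g mulgKV.
have e2 : (x * g s)^-1 * t * (x * g s) = g s.
  transitivity ((g s)^-1 * (x^-1 * t * x) * g s); first by rewrite invgM !mulgA.
  by rewrite e1 mulVg mul1g.
by rewrite invbM e2 invbM e1 invbV -et invb_gen eqxx; case: (invb x t).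
Qed.

Lemma refls_split w t : t \in refls w ->
  exists w1 s w2, w = w1 ++ s :: w2 /\ t * wprod w = wprod (w1 ++ w2).
Proof.
elim: w t => //= s w IH t; rewrite inE => /predU1P[->|/mapP[t' /IH[w1 [r [w2 [-> h]]]] ->]].
  by exists [::], s, w; rewrite wprod_cons genK.
by exists (s :: w1), r, w2; split=> //=; rewrite !wprod_cons -h -!mulgA genK.
Qed.

Lemma refls_del w t : t \in refls w ->
  exists w', [/\ t * wprod w = wprod w', (size w').+1 = size w & subseq w' w].
Proof.
move=> /refls_split[w1 [s [w2 [-> h]]]]; exists (w1 ++ w2); split=> //.
  by rewrite !size_cat addnS.
by rewrite cat_subseq // subseq_cons.
Qed.

Lemma invb_del w t : invb (wprod w) t -> t \in refls w.
Proof. by rewrite invb_wprod /rpar -has_pred1 has_count; case: (count _ _). Qed.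

Lemma invb_len x t : invb x t -> len C (t * x) < len C x.
Proof.
rewrite -{1}(rwordE x) => /invb_del/refls_del[w [h hs _]].
by rewrite -(size_rword x) -hs ltnS -{1}(rwordE x) h len_wprod.
Qed.

Lemma invb_mulr x t : refl t -> invb (t * x) t = ~~ invb x t.
Proof. by move=> h; rewrite invbM invb_self // mulVg mul1g. Qed.

Lemma ltn_lenr x t : refl t -> (len C (t * x) < len C x) = invb x t.
Proof.
move=> h; apply/idP/idP => [|/invb_len//]; apply: contraLR => n.
have := @invb_len (t * x) t; rewrite invb_mulr // n mulgA reflP // mul1g => /(_ isT).
by lia.
Qed.

Lemma ltn_lenrN x t : refl t -> (len C x < len C (t * x)) = ~~ invb x t.
Proof.
by move=> h; rewrite -invb_mulr // -ltn_lenr // mulgA reflP // mul1g.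
Qed.

Lemma lenV x : len C x^-1 = len C x.
Proof.
suff h y : len C y^-1 <= len C y.
  by apply/eqP; rewrite eqn_leq h -{1}(invgK x) h.
rewrite -(size_rword y) -{1}(rwordE y) -(size_rev (rword y)).
suff -> : (wprod (rword y))^-1 = wprod (rev (rword y)) by exact: len_wprod.
elim: (rword y) => [|s w IH]; first by rewrite wprod_nil invg1.
by rewrite rev_cons -cats1 wprod_cat !wprod_cons wprod_nil mulg1 invgM IH genV.
Qed.

Lemma lenM x y : len C (x * y) <= len C x + len C y.
Proof.
by rewrite -{1}(rwordE x) -{1}(rwordE y) -wprod_cat (leq_trans (len_wprod _)) //
  size_cat !size_rword.
Qed.

Lemma len1 : len C 1 = 0%N.
Proof. by have := len_wprod [::]; rewrite wprod_nil; case: (len _ _). Qed.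

Lemma len_eq0 x : (len C x == 0%N) = (x == 1).
Proof.
apply/eqP/eqP => [|->]; last exact: len1.
by rewrite -size_rword => /size0nil h; rewrite -(rwordE x) h wprod_nil.
Qed.

Lemma len_gen s : len C (g s) = 1%N.
Proof.
have := len_wprod [:: s]; rewrite wprod_cons wprod_nil mulg1 /= => h.
have : len C (g s) != 0%N; last by lia.
by rewrite len_eq0; apply/eqP => e; have := invb_self (refl_gen s); rewrite e invb1.
Qed.

Lemma len_genl s x :
  if invb x (g s) then len C x = (len C (g s * x)).+1
  else len C (g s * x) = (len C x).+1.
Proof.
have h1 := lenM (g s) x; have h2 := lenM (g s) (g s * x).
rewrite genK len_gen in h2; rewrite len_gen in h1.
case: ifPn => h.
  by move: h; rewrite -ltn_lenr; [lia | exact: refl_gen].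
by move: h; rewrite -ltn_lenrN; [lia | exact: refl_gen].
Qed.

Lemma len_genl_neq s x : len C (g s * x) <> len C x.
Proof. by have := len_genl s x; case: ifP; lia. Qed.

Lemma ltn_lenrr x t : refl t -> (len C (x * t) < len C x) = invb x^-1 t.
Proof. by move=> h; rewrite -ltn_lenr // lenV -(lenV (t * _)) invgM invgK reflV. Qed.

Lemma ltn_lenrrN x t : refl t -> (len C x < len C (x * t)) = ~~ invb x^-1 t.
Proof. by move=> h; rewrite -ltn_lenrN // lenV -(lenV (t * _)) invgM invgK reflV. Qed.

Lemma len_genr s x :
  if invb x^-1 (g s) then len C x = (len C (x * g s)).+1
  else len C (x * g s) = (len C x).+1.
Proof.
have e : g s * x^-1 = (x * g s)^-1 by rewrite invgM genV.
by have := len_genl s x^-1; rewrite e !lenV.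
Qed.

Lemma refls_uniq w : len C (wprod w) = size w -> uniq (refls w).
Proof.
elim: w => //= s w IH; rewrite wprod_cons => h.
have hw : len C (wprod w) = size w.
  have := lenM (g s) (wprod w); rewrite h len_gen.
  by have := len_wprod w; lia.
rewrite map_inj_uniq ?IH ?andbT //; last by move=> t t' /mulIg /mulgI.
apply/mapP => -[t tw e].
have {}e : t = g s.
  have -> : t = g s * (g s * t * g s) * g s by rewrite !mulgA gen_sq mul1g mulg_genK.
  by rewrite -e gen_sq mul1g.
have [w' [e' hs _]] := refls_del tw.
by have := len_wprod w'; rewrite -e' e h; lia.
Qed.

Lemma mem_refls w t : len C (wprod w) = size w -> (t \in refls w) = invb (wprod w) t.
Proof.
move=> /refls_uniq h; rewrite invb_wprod /rpar count_uniq_mem //.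
by case: (t \in _).
Qed.

End Reflections.

(** * Reflection orders, Bruhat order and parabolic subgroups *)

Section ReflectionOrder.
Variables (S : finType) (W : groupType) (C : coxeter_system S W).
Implicit Types (x y t : W) (s : S).
Local Open Scope group_scope.
Local Notation g := (gen C).
Local Notation refl := (reflections C).
Variable f : W -> int.
Local Notation ro := (refl_order C f).

Lemma ro_refl x : ro x x.
Proof. exact: rt_refl. Qed.

Lemma ro_trans y x z : ro x y -> ro y z -> ro x z.
Proof. exact: rt_trans. Qed.

Lemma ro_step x t : refl t -> (f x < f (t * x)%g)%R -> ro x (t * x).
Proof. by move=> rt h; apply: rt_step; exists t. Qed.

Lemma ro_eq_lt x y : ro x y -> x = y \/ (f x < f y)%R.
Proof.
elim=> {x y}.
- by move=> x y [t _ [-> h]]; right.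
- by move=> x; left.
by move=> x y z _ [->|h1] _ [<-|h2]; [left|right|right|right; lia].
Qed.

Lemma ro_le x y : ro x y -> (f x <= f y)%R.
Proof. by case/ro_eq_lt => [->|]; lia. Qed.

Lemma ro_ge_eq x y : ro x y -> (f y <= f x)%R -> x = y.
Proof. by move=> /ro_eq_lt[//|h]; lia. Qed.

Hypothesis f_gen : forall s x, f (g s * x) <> f x.
Hypothesis f_key : forall s t x, refl t -> t <> g s ->
  (f x < f (t * x)%g -> f (g s * x)%g < f (g s * (t * x))%g)%R.

Lemma ro_genE s x : ro (g s * x) x <-> (f (g s * x)%g < f x)%R.
Proof.
split=> [/ro_eq_lt[e|//]|h]; first by case: (f_gen (s := s) (x := x)); rewrite e.
by rewrite -[x in ro _ x](genK C s); apply: ro_step; rewrite ?genK //; apply: refl_gen.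
Qed.

Lemma ro_genW s x : (f x < f (g s * x)%g)%R -> ro x (g s * x).
Proof. by apply: ro_step; apply: refl_gen. Qed.

Let dn s x := if (f (g s * x)%g < f x)%R then g s * x else x.
Let up s x := if (f (g s * x)%g < f x)%R then x else g s * x.

Let ro_mono s x y : ro x y -> ro (dn s x) (dn s y) /\ ro (up s x) (up s y).
Proof.
elim=> {x y}; last 2 first.
- by split; apply: ro_refl.
- by move=> x y z _ [h1 h2] _ [h3 h4]; split; apply: (ro_trans (y := _)); eassumption.
move=> x y [t rt [-> h]]; case: (t =P g s) => [->|nt].
  rewrite /dn /up genK; have := @f_gen s x.
  by case: ifP; case: ifP; try (by split; apply: ro_refl); lia.
have h' := f_key rt nt h.
have r1 := ro_step rt h.
have r2 : ro (g s * x) (g s * (t * x)).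
  have e : g s * (t * x) = (g s * t * (g s)^-1) * (g s * x) by rewrite !mulgA mulgKV.
  by rewrite e; apply: ro_step; [apply: reflJ | rewrite -e].
rewrite /dn /up; case: ifP => h1; case: ifP => h2; split=> //.
- by apply: ro_trans r1; apply/ro_genE.
- by apply: ro_trans r1 _; apply: ro_genW; have := @f_gen s (t * x); lia.
- by apply: ro_trans r2; apply: ro_genW; have := @f_gen s x; lia.
- by apply: ro_trans r2 _; apply/ro_genE.
Qed.

Lemma ro_dd s x y : ro x y -> (f (g s * x)%g < f x)%R -> (f (g s * y)%g < f y)%R ->
  ro (g s * x) (g s * y).
Proof. by move=> /(ro_mono s)[]; rewrite /dn => + _ h1 h2; rewrite h1 h2. Qed.

Lemma ro_uu s x y : ro x y -> (f x < f (g s * x)%g)%R -> (f y < f (g s * y)%g)%R ->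
  ro (g s * x) (g s * y).
Proof.
move=> /(ro_mono s)[_]; rewrite /up => + h1 h2.
by rewrite !ifF //; lia.
Qed.

Lemma ro_lift s x y : ro x y -> (f x < f (g s * x)%g)%R -> (f (g s * y)%g < f y)%R ->
  ro x (g s * y) /\ ro (g s * x) y.
Proof.
move=> /(ro_mono s); rewrite /dn /up => + h1 h2.
by rewrite h2 !ifF //; lia.
Qed.

End ReflectionOrder.

Section Bruhat.
Variables (S : finType) (W : groupType) (C : coxeter_system S W).
Implicit Types (x y t : W) (s : S).
Local Open Scope group_scope.
Local Notation g := (gen C).
Local Notation refl := (reflections C).
Local Notation bruhat := (bruhat C).
Local Notation len := (len C).

Lemma bruhat_refl x : bruhat x x.
Proof. exact: ro_refl. Qed.

Lemma bruhat_trans y x z : bruhat x y -> bruhat y z -> bruhat x z.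
Proof. exact: ro_trans. Qed.

Lemma bruhat_len x y : bruhat x y -> len x <= len y.
Proof. by move=> /ro_le; lia. Qed.

Lemma bruhat_len_eq x y : bruhat x y -> len y <= len x -> x = y.
Proof. by move=> /ro_ge_eq h1 h2; apply: h1; lia. Qed.

Lemma bruhat_step x t : invb C x t -> bruhat (t * x) x.
Proof.
move=> h; have rt := invb_refl h.
have e : t * (t * x) = x by rewrite mulgA (reflP rt) mul1g.
by rewrite -{2}e; apply: ro_step rt _; rewrite e; have := invb_len h; lia.
Qed.

Lemma bruhat_stepr x t : invb C x^-1 t -> bruhat (x * t) x.
Proof.
move=> h; have -> : x * t = (x * t * x^-1) * x by rewrite mulgKV.
by apply: bruhat_step; rewrite -invbV.
Qed.

Lemma bruhat_ind_step (P : W -> W -> Prop) :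
  (forall x, P x x) -> (forall x y z, P x y -> P y z -> P x z) ->
  (forall x t, invb C x t -> P (t * x) x) ->
  forall x y, bruhat x y -> P x y.
Proof.
move=> P1 PT PS x y; elim=> {x y} //; last by move=> x y z _ h _; apply: PT h.
move=> x y [t rt [-> h]].
have e : t * (t * x) = x by rewrite mulgA (reflP rt) mul1g.
by rewrite -{1}e; apply: PS; rewrite -ltn_lenr // e; lia.
Qed.

Lemma bruhatV x y : bruhat x y -> bruhat x^-1 y^-1.
Proof.
move: x y; apply: bruhat_ind_step => [x|x y z|x t h]; first exact: bruhat_refl.
  exact: bruhat_trans.
rewrite invgM (reflV (invb_refl h)); apply: bruhat_stepr.
by rewrite invgK.
Qed.

Let len_gen_neq s x : ((len (g s * x))%:Z)%R <> (len x)%:Z%R.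
Proof. by have := @len_genl_neq _ _ C s x; lia. Qed.

Let len_key s t x : refl t -> t <> g s ->
  ((len x)%:Z < (len (t * x)%g)%:Z ->
   (len (g s * x)%g)%:Z < (len (g s * (t * x))%g)%:Z)%R.
Proof.
move=> rt nt h; have e : g s * (t * x) = (g s * t * (g s)^-1) * (g s * x).
  by rewrite !mulgA mulgKV.
rewrite e; have : len (g s * x) < len (g s * t * (g s)^-1 * (g s * x)); last by lia.
rewrite ltn_lenrN; last exact: reflJ.
rewrite invbM invb_gen -!mulgA mulKg mulVg mulg1.
have -> : invb C x t = false by apply: negbTE; rewrite -ltn_lenrN //; lia.
rewrite addbF genV; apply/eqP => e2; apply: nt.
by apply: (mulgI (g s)); apply: (mulIg (g s)); rewrite -mulgA e2 gen_sq mul1g.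
Qed.

Lemma desc_ex x n : len x = n.+1 -> exists s, len (g s * x) = n.
Proof.
move=> hn; case ex: (rword C x) (size_rword C x) (rwordE C x) => [|s v] /=.
  by rewrite hn.
rewrite hn wprod_cons => -[hv] ex'; exists s; rewrite -ex' genK.
apply/eqP; rewrite eqn_leq -{1}hv len_wprod /=.
by have := lenM C (g s) (wprod C v); rewrite ex' len_gen hn; lia.
Qed.

Lemma bruhat_dd s x y : bruhat x y -> len (g s * x) < len x -> len (g s * y) < len y ->
  bruhat (g s * x) (g s * y).
Proof. exact: (ro_dd len_gen_neq len_key). Qed.

Lemma bruhat_uu s x y : bruhat x y -> len x < len (g s * x) -> len y < len (g s * y) ->
  bruhat (g s * x) (g s * y).
Proof. exact: (ro_uu len_gen_neq len_key). Qed.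

Lemma bruhat_lift s x y : bruhat x y -> len x < len (g s * x) -> len (g s * y) < len y ->
  bruhat x (g s * y) /\ bruhat (g s * x) y.
Proof. exact: (ro_lift len_gen_neq len_key). Qed.

Lemma bruhat_liftr s x y : bruhat x y -> len x < len (x * g s) -> len (y * g s) < len y ->
  bruhat (x * g s) y.
Proof.
have e z : z * g s = (g s * z^-1)^-1 by rewrite invgM invgK genV.
rewrite !e !lenV -(lenV C x) -(lenV C y) => /bruhatV h h1 h2.
by have [_ /bruhatV] := bruhat_lift h h1 h2; rewrite invgK.
Qed.

Lemma bruhat_uur s x y : bruhat x y -> len x < len (x * g s) -> len y < len (y * g s) ->
  bruhat (x * g s) (y * g s).
Proof.
have e z : z * g s = (g s * z^-1)^-1 by rewrite invgM invgK genV.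
rewrite !e !lenV -(lenV C x) -(lenV C y) => /bruhatV h h1 h2.
by apply: bruhatV; apply: bruhat_uu.
Qed.

Lemma bruhat_genr s x : len x < len (x * g s) -> bruhat x (x * g s).
Proof.
move=> h; rewrite -{1}(mulg_genK C s x); apply: bruhat_stepr.
by rewrite -ltn_lenrr ?mulg_genK //; apply: refl_gen.
Qed.

Lemma bruhat_mulr s x y : bruhat x y -> len y < len (y * g s) ->
  bruhat (x * g s) (y * g s).
Proof.
move=> h hy; have := len_genr C s x; case: ifP => hx.
  move=> lx; apply: (bruhat_trans (y := x)).
    exact: bruhat_stepr.
  by apply: bruhat_trans h _; apply: bruhat_genr.
by move=> lx; apply: bruhat_uur => //; rewrite lx.
Qed.

End Bruhat.

Section Parabolic.
Variables (S : finType) (W : groupType) (C : coxeter_system S W).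
Implicit Types (x y t a : W) (s : S) (I J : {set S}).
Local Open Scope group_scope.
Local Notation g := (gen C).
Local Notation refl := (reflections C).
Local Notation bruhat := (bruhat C).
Local Notation len := (len C).
Local Notation par := (parabolic C).
Local Notation invb := (invb C).

Lemma par1 I : par I 1.
Proof. by exists [::]; rewrite ?big_nil. Qed.

Lemma parM I x y : par I x -> par I y -> par I (x * y).
Proof.
move=> [v hv ->] [w hw ->]; exists (v ++ w); first by rewrite all_cat hv.
by rewrite big_cat.
Qed.

Lemma par_gen I s : s \in I -> par I (g s).
Proof. by move=> sI; exists [:: s]; rewrite ?big_seq1 //= sI. Qed.

Lemma parV I x : par I x -> par I x^-1.
Proof.
move=> [w + ->]; elim: w => [_|s w IH /= /andP[sI /IH h]].
  by rewrite big_nil invg1; apply: par1.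
by rewrite big_cons invgM genV; apply: parM => //; apply: par_gen.
Qed.

Lemma parVE I x : par I x^-1 <-> par I x.
Proof. by split=> /parV; rewrite ?invgK. Qed.

Lemma parMl I x y : par I x -> (par I (x * y) <-> par I y).
Proof.
by move=> h; split=> [|/(parM h)//]; move/(parM (parV h)); rewrite mulKg.
Qed.

Lemma parMr I x y : par I y -> (par I (x * y) <-> par I x).
Proof.
move=> h; split=> [|/parM]; last exact.
by move/parM => /(_ _ (parV h)); rewrite mulgK.
Qed.

Lemma parJ I x t : par I x -> (par I (x * t * x^-1) <-> par I t).
Proof. by move=> h; rewrite parMr ?parVE // parMl. Qed.

Lemma par_sub I J x : I \subset J -> par I x -> par J x.
Proof.
move=> /fintype.subsetP IJ [w hw ->]; exists w => //.
by apply: sub_all hw => s /IJ.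
Qed.

Lemma par_refls I (w : seq S) t : all (mem I) w -> t \in refls C w -> par I t.
Proof.
elim: w t => //= s w IH t /andP[sI h]; rewrite inE => /predU1P[->|/mapP[t' /(IH _ h) h' ->]].
  exact: par_gen.
by rewrite -{2}(genV C s) parJ //; apply: par_gen.
Qed.

Lemma par_invb I x t : par I x -> invb x t -> par I t.
Proof. by move=> [w hw ->] /invb_del; apply: par_refls. Qed.

Lemma par_rword I x : par I x ->
  exists w : seq S, [/\ all (mem I) w, x = wprod C w & size w = len x].
Proof.
move=> [w + ->]; elim: w => [_|s w IH /= /andP[sI /IH[v [hv hv' hl]]]].
  by exists [::]; rewrite big_nil wprod_nil len1.
rewrite big_cons hv'; have := len_genl C s (wprod C v); case: ifP => [h|_] hs.
  have [v' [e hs' sv]] := refls_del (invb_del h).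
  exists v'; split=> //; last first.
    by move: hs; rewrite -hv' -hl -hs'; rewrite -hv' in e *; rewrite e; lia.
  by apply/allP => r /(mem_subseq sv); apply/allP.
by exists (s :: v); rewrite /= sI hv wprod_cons hs hl hv'.
Qed.

Definition mincoset I a := forall t, par I t -> ~~ invb a^-1 t.

Lemma mincoset1 I : mincoset I 1.
Proof. by move=> t _; rewrite invg1 invb1. Qed.

Lemma mincoset_gen I a s : mincoset I a -> s \in I -> len (a * g s) = (len a).+1.
Proof.
move=> h /par_gen/h; have := len_genr C s a.
by case: ifP.
Qed.

Lemma mincoset_add I a w : mincoset I a -> par I w -> len (a * w) = (len a + len w)%N.
Proof.
move=> ha /parV/par_rword[v [hv ev hl]].
have hs : len (wprod C v) = size v by rewrite -ev hl.
rewrite -(invgK w) ev lenV hs {w ev hl}.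
elim: v hv hs => [|s v IH] /=; first by rewrite wprod_nil invg1 mulg1 addn0.
rewrite wprod_cons => /andP[sI hv] hs.
have hv' : len (wprod C v) = size v.
  by have := lenM C (g s) (wprod C v); have := len_wprod C v; rewrite len_gen; lia.
rewrite invgM genV mulgA; have := len_genr C s (a * (wprod C v)^-1).
rewrite IH // ifF => [->|]; first by rewrite addnS.
rewrite invgM invgK invbM; have -> : invb (wprod C v) (g s) = false.
  by have := len_genl C s (wprod C v); rewrite hs hv'; case: ifP => //; lia.
apply: negbTE; apply: ha; have pv : par I (wprod C v) by exists v.
by apply: parM => //; apply: parM; [apply: parV | apply: par_gen].
Qed.

Lemma coset_decomp I x : exists a w, [/\ mincoset I a, par I w & x = a * w].
Proof.
have ex : exists n, `[< exists2 w, par I w & len (x * w) = n >].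
  by exists (len x); apply/asboolP; exists 1; rewrite ?mulg1 //; apply: par1.
case: (ex_minnP ex) => n /asboolP[w pw <-] hmin.
exists (x * w), w^-1; split; [|exact: parV|by rewrite mulgK].
move=> t pt; apply/negP => h; have rt := invb_refl h.
have := hmin (len (x * w * t)); have : len (x * w * t) < len (x * w) by rewrite ltn_lenrr.
rewrite ltnNge => /negP h1 h2; apply: h1; apply: h2.
by apply/asboolP; exists (w * t); rewrite ?mulgA //; apply: parM.
Qed.

Lemma mincosetP I a : (forall s, s \in I -> len a < len (a * g s)) -> mincoset I a.
Proof.
have [b [w [hb pw ->]]] := coset_decomp I a => h.
case: (eqVneq w 1) => [->|nw]; first by rewrite mulg1.
have [v [hv ev hl]] := par_rword (parV pw).
case: v hv ev hl => [_ e|s v /= /andP[sI hv] ev hl].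
  by move: nw; rewrite -(invgK w) e wprod_nil invg1 eqxx.
have := h s sI; rewrite -mulgA !(mincoset_add hb) //; last by apply: parM => //; apply: par_gen.
have -> : w * g s = (wprod C v)^-1 by rewrite -(invgK w) ev wprod_cons invgM genV mulg_genK.
by rewrite !lenV in hl *; have := len_wprod C v; lia.
Qed.

Lemma mincoset_uniq I a b v w : mincoset I a -> mincoset I b -> par I v -> par I w ->
  a * v = b * w -> a = b /\ v = w.
Proof.
move=> ha hb pv pw e.
have e1 : b = a * (v * w^-1) by rewrite mulgA e mulgK.
have e2 : a = b * (w * v^-1) by rewrite mulgA -e mulgK.
have l1 := mincoset_add ha (parM pv (parV pw)); rewrite -e1 in l1.
have l2 := mincoset_add hb (parM pw (parV pv)); rewrite -e2 in l2.
have /eqP : len (v * w^-1) = 0%N by lia.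
rewrite len_eq0 => /eqP e3; rewrite e1 e3 mulg1; split=> //.
by apply: (mulIg w^-1); rewrite e3 mulgV.
Qed.

Lemma mincoset_invb_par I a w t : mincoset I a -> par I w -> par I t ->
  invb (a * w)^-1 t = invb w^-1 t.
Proof.
move=> ha pw pt; rewrite invgM invbM invgK.
by rewrite (negbTE (ha _ _)) ?addbF //; apply/parJ.
Qed.

Lemma mincoset_invb_npar I a w t : par I w -> ~ par I t ->
  invb (a * w)^-1 t = invb a^-1 (w * t * w^-1).
Proof.
move=> pw nt; rewrite invgM invbM invgK.
suff -> : invb w^-1 t = false by [].
by apply/negP => /(par_invb (parV pw)).
Qed.

Lemma mincoset_desc I a s : mincoset I a -> len (g s * a) < len a -> mincoset I (g s * a).
Proof.
move=> ha h; apply: mincosetP => r rI.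
have := mincoset_gen ha rI; have := len_genl C s (a * g r); have := len_genl C s a.
have -> : g s * (a * g r) = g s * a * g r by rewrite mulgA.
by case: ifP => _; case: ifP => _; lia.
Qed.

Lemma mincoset_left I a s : mincoset I a ->
  mincoset I (g s * a) \/ exists2 r, r \in I & g s * a = a * g r.
Proof.
move=> ha; case: (pselect (exists2 r, r \in I & g s * a = a * g r)); first by right.
move=> h; left; apply: mincosetP => r rI.
rewrite ltnNge; apply/negP => hl.
have l1 := mincoset_gen ha rI; have e : g s * (a * g r) = g s * a * g r by rewrite mulgA.
have := len_genl C s (a * g r); have := len_genl C s a; have := len_genr C r (g s * a).
rewrite invbM invb_gen e; case: (_ =P g r) => [e2 _ _ _|_].
  by apply: h; exists r => //; rewrite -e2 !mulgA mulgV mul1g.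
by rewrite addbF; case: ifP => _; case: ifP => _; lia.
Qed.

Lemma minrepsP I a : reflect (mincoset I a) (a \in minreps C I).
Proof.
apply: (iffP (asboolP _)) => h.
  apply: mincosetP => s /h/bruhat_len; have := len_genr C s a.
  by case: ifP; lia.
by move=> s sI; apply: bruhat_genr; rewrite (mincoset_gen h).
Qed.

End Parabolic.

(** * The geometric representation separates the generators *)

Section GeometricRepresentation.
Variables (S : finType) (W : groupType) (C : coxeter_system S W).
Local Open Scope ring_scope.
Local Notation m := (cox_mat C).

Let zeta (k : nat) : algC :=
  if pselect (exists z : algC, (k.*2).-primitive_root z) is left e then projT1 (cid e) else 1.

Let zetaP k : (0 < k)%N -> (k.*2).-primitive_root (zeta k).
Proof.
move=> k0; rewrite /zeta; case: pselect => [e|[]]; first exact: projT2 (cid e).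
by have [|z hz] := @C_prim_root_exists k.*2; [rewrite double_gt0 | exists z].
Qed.

(* [- (z + z^-1)] is [-2 cos (pi / m)]; the value for [m = 0] is irrelevant, as no
   relation is imposed then. *)
Let cartan (s t : S) : algC :=
  if s == t then 2 else - (zeta (m s t) + (zeta (m s t))^-1).

Let form (s : S) (v : {ffun S -> algC}) : algC := \sum_r v r * cartan s r.
Let root (s : S) : {ffun S -> algC} := [ffun r => (r == s)%:R].
Let sc (c : algC) (v : {ffun S -> algC}) : {ffun S -> algC} := [ffun r => c * v r].
Local Notation "c *: v" := (sc c v) : ring_scope.
Let sigma (s : S) (v : {ffun S -> algC}) := v - form s v *: root s.

Let form_root s t : form s (root t) = cartan s t.
Proof.
rewrite /form (bigD1 t) //= ffunE eqxx mul1r big1 ?addr0 // => r /negPf h.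
by rewrite ffunE h mul0r.
Qed.

Let formD s v w : form s (v + w) = form s v + form s w.
Proof. by rewrite -big_split; apply: eq_bigr => r _; rewrite ffunE mulrDl. Qed.

Let formZ s c v : form s (c *: v) = c * form s v.
Proof. by rewrite /form mulr_sumr; apply: eq_bigr => r _; rewrite ffunE mulrA. Qed.

Let scN c v : - c *: v = - (c *: v).
Proof. by apply/ffunP => r; rewrite !ffunE mulNr. Qed.

Lemma lin_rec_sum0 (k : nat) (z : algC) (x : nat -> algC) :
  (2 < k)%N -> k.-primitive_root z ->
  (forall i, x i.+2 = (z + z^-1) * x i.+1 - x i) -> \sum_(i < k) x i = 0.
Proof.
move=> k2 hz hx; have k0 : (0 < k)%N by apply: leq_trans k2.
have z0 : z != 0 by apply: contra_eq_neq (prim_expr_order hz) => ->;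
    rewrite expr0n; case: (k) k0 => //= *; rewrite eq_sym oner_neq0.
have z1 : z - 1 != 0.
  rewrite subr_eq0; apply/eqP => e.
  by have := prim_order_dvd hz 1; rewrite expr1 e eqxx dvdn1; lia.
have z2 : z - z^-1 != 0.
  rewrite subr_eq0; apply/eqP => e.
  have := prim_order_dvd hz 2; rewrite expr2 {1}e mulVf // eqxx => /dvdn_leq.
  by lia.
have closed i : x i * (z - z^-1) = z ^+ i * (x 1%N - z^-1 * x 0%N)
                                   - (z^-1) ^+ i * (x 1%N - z * x 0%N).
  suff: x i * (z - z^-1) = z ^+ i * (x 1%N - z^-1 * x 0%N)
                                   - (z^-1) ^+ i * (x 1%N - z * x 0%N) /\
        x i.+1 * (z - z^-1) = z ^+ i.+1 * (x 1%N - z^-1 * x 0%N)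
                                   - (z^-1) ^+ i.+1 * (x 1%N - z * x 0%N) by case.
  elim: i => [|i [IH1 IH2]]; first by rewrite !expr0 !expr1; split; field.
  split=> //; rewrite hx mulrBl -mulrA IH1 IH2 !exprS.
  set a := z ^+ i; set b := z^-1 ^+ i; by field.
have geom (y : algC) : y - 1 != 0 -> y ^+ k = 1 -> \sum_(i < k) y ^+ i = 0.
  move=> y1 yk; apply: (mulfI y1).
  by rewrite -subrX1 yk subrr mulr0.
have zV1 : z^-1 - 1 != 0.
  by rewrite subr_eq0 invr_eq1 -subr_eq0.
apply: (mulIf z2); rewrite mul0r mulr_suml.
under eq_bigr do rewrite closed.
rewrite sumrB -!mulr_suml !geom ?mul0r ?subrr //; last exact: (prim_expr_order hz).
by rewrite exprVn (prim_expr_order hz) invr1.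
Qed.

Let sigma_rel s t v : s != t -> iter (m s t) (sigma s \o sigma t) v = v.
Proof.
move=> st; case: (posnP (m s t)) => [->//|m0].
set k := m s t in m0 *; set a := cartan s t.
have k1 : (1 < k)%N.
  by have := cox_mat_diag C s t; rewrite (negPf st) -/k; case: (k) m0 => [|[]].
have ca : a = - (zeta k + (zeta k)^-1) by rewrite /a /cartan (negPf st).
have ca' : cartan t s = a.
  by rewrite /a /cartan eq_sym (negPf st) cox_mat_sym.
have css r : cartan r r = 2 by rewrite /cartan eqxx.
pose M (x : algC * algC) := ((a ^+ 2 - 1) * x.1 + a * x.2, - x.2 - a * x.1).
have PU x : sigma s (sigma t (x.1 *: root s + x.2 *: root t)) =
            (M x).1 *: root s + (M x).2 *: root t.
  rewrite /sigma !(formD, formZ) -!scN !(formD, formZ) !form_root ca' !css -/a.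
  by apply/ffunP => r; rewrite !ffunE /=; ring.
have PD u w : sigma s (sigma t (u + w)) = sigma s (sigma t u) + sigma s (sigma t w).
  rewrite /sigma !(formD, formZ) -!scN !(formD, formZ).
  by apply/ffunP => r; rewrite !ffunE /=; ring.
pose x0 := (- (form s v - form t v * a), - form t v).
have P0 : sigma s (sigma t v) = v + (x0.1 *: root s + x0.2 *: root t).
  rewrite /sigma -scN !(formD, formZ) form_root -/a.
  by apply/ffunP => r; rewrite !ffunE /=; ring.
pose p i := (iter i M x0).1; pose q i := (iter i M x0).2.
have it i : iter i (sigma s \o sigma t) v =
    v + ((\sum_(j < i) p j) *: root s + (\sum_(j < i) q j) *: root t).
  elim: i => [|i IH]; first by rewrite !big_ord0; apply/ffunP => r; rewrite !ffunE !mul0r !addr0.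
  rewrite iterS IH [LHS]PD P0 (PU (\sum_(j < i) p j, \sum_(j < i) q j)) -!addrA; congr (_ + _).
  have [-> ->] : \sum_(j < i.+1) p j = x0.1 + (M (\sum_(j < i) p j, \sum_(j < i) q j)).1 /\
               \sum_(j < i.+1) q j = x0.2 + (M (\sum_(j < i) p j, \sum_(j < i) q j)).2.
    rewrite !big_ord_recl; split; congr (_ + _) => /=; rewrite ?mulr_sumr -?sumrN -big_split.
      by apply: eq_bigr.
    by rewrite /=; apply: eq_bigr => j _ /=; rewrite /q /p -[bump _ _]/(j.+1) iterS.
  by apply/ffunP => r; rewrite !ffunE /=; ring.
have hz := zetaP m0; set z := zeta k in ca hz.
have z0 : z != 0 by apply: contra_eq_neq (prim_expr_order hz) => ->;
    rewrite expr0n; case: (k) m0 => //= *; rewrite eq_sym oner_neq0.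
have rec i : p i.+2 = (z ^+ 2 + (z ^+ 2)^-1) * p i.+1 - p i /\
             q i.+2 = (z ^+ 2 + (z ^+ 2)^-1) * q i.+1 - q i.
  rewrite /p /q !iterS; set y := iter i M x0; rewrite /= ca; split; by field.
suff [hp hq] : \sum_(j < k) p j = 0 /\ \sum_(j < k) q j = 0.
  by rewrite it hp hq; apply/ffunP => r; rewrite !ffunE !mul0r !addr0.
case: (eqVneq k 2) => [k2|k2].
  have a0 : a = 0.
    have /eqP := prim_expr_order hz; rewrite k2 -[2.*2]/(2 * 2)%N exprM -subr_eq0 subr_sqr_1.
    rewrite mulf_eq0 => /orP[] /eqP e.
      have := prim_order_dvd hz 2; rewrite k2 -subr_eq0 e eqxx.
      by [].
    rewrite ca; apply/eqP; rewrite oppr_eq0; apply/eqP; apply: (mulIf z0).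
    by rewrite mulrDl mulVf // -expr2 e mul0r.
  by rewrite k2 !big_ord_recl !big_ord0 /p /q /= a0; split; ring.
have hz2 : k.-primitive_root (z ^+ 2).
  by have := exp_prim_root hz 2; rewrite -muln2 gcdnMl mulnK.
split; apply: (lin_rec_sum0 (z := z ^+ 2)) => //; try lia.
  by move=> i; case: (rec i).
by move=> i; case: (rec i).
Qed.

Let sigma_sq s v : sigma s (sigma s v) = v.
Proof.
rewrite /sigma -scN formD formZ form_root /cartan eqxx.
by apply/ffunP => r; rewrite !ffunE /=; ring.
Qed.

Lemma gen_inj : injective (gen C).
Proof.
pose act (w : seq S) v := foldr sigma v w.
have act_congr v w : cox_congr m v w -> act v =1 act w.
  elim=> {v w} //.
  - by move=> v w _ h x; rewrite h.
  - by move=> v w u _ h1 _ h2 x; rewrite h1 h2.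
  move=> v w s t x; rewrite /act !foldr_cat; congr (foldr _ _ v).
  have -> k y : foldr sigma y (flatten (nseq k [:: s; t])) = iter k (sigma s \o sigma t) y.
    by elim: k => //= k ->.
  case: (eqVneq s t) => [<-|st]; last exact: sigma_rel.
  have /eqP -> : m s s == 1%N by rewrite cox_mat_diag.
  by rewrite /= sigma_sq.
move=> s t e; apply: contra_eq (erefl (1 : algC)) => st.
have : cox_congr m [:: s] [:: t] by apply/(cox_pres C); rewrite !big_seq1.
move/act_congr/(_ (root s))/ffunP/(_ s).
rewrite /act /= /sigma !form_root !ffunE /cartan eqxx (negPf st).
rewrite mulr0 subr0 mulr1 => /eqP.
by rewrite subr_eq -subr_eq0 opprD addNKr oppr_eq0 pnatr_eq0.
Qed.

End GeometricRepresentation.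

(** * Laurent polynomials *)

Section LaurentFacts.
Local Open Scope ring_scope.
Implicit Types f g h : laurent.

Lemma lcoefD f g k : lcoef (f + g) k = lcoef f k + lcoef g k.
Proof. exact: laddE. Qed.

Lemma lcoefN f k : lcoef (- f) k = - lcoef f k.
Proof. exact: loppE. Qed.

Lemma lcoef0 k : lcoef 0 k = 0.
Proof. exact: lzeroE. Qed.

Lemma lcoef1 k : lcoef 1 k = (k == 0)%:R.
Proof. exact: loneE. Qed.

Lemma lcoefM f g k : lcoef (f * g) k = \sum_(i <- lsupp f) lcoef f i * lcoef g (k - i).
Proof. exact: lmulE. Qed.

Lemma barK : involutive bar.
Proof. by move=> f; apply: laurentP => k; rewrite !barE opprK. Qed.

Lemma barD f g : bar (f + g) = bar f + bar g.
Proof. by apply: laurentP => k; rewrite !(barE, lcoefD). Qed.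

Lemma barN f : bar (- f) = - bar f.
Proof. by apply: laurentP => k; rewrite !(barE, lcoefN). Qed.

Lemma bar0 : bar 0 = 0.
Proof. by apply: laurentP => k; rewrite barE !lcoef0. Qed.

Lemma bar1 : bar 1 = 1.
Proof. by apply: laurentP => k; rewrite barE !lcoef1 oppr_eq0. Qed.

Lemma barM f g : bar (f * g) = bar f * bar g.
Proof.
apply: laurentP => k; rewrite barE !lcoefM.
transitivity (\sum_(i <- [seq - i | i <- lsupp (bar f)]) lcoef f i * lcoef g (- k - i)).
  apply: sum_supp; rewrite ?fset_uniq ?(map_inj_uniq oppr_inj) ?fset_uniq //.
  move=> i; rewrite mulf_eq0 negb_or => /andP[fi _]; rewrite -lsuppP fi /=.
  by apply/mapP; exists (- i); rewrite ?opprK // -lsuppP barE opprK.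
by rewrite big_map; apply: eq_bigr => i _; rewrite !barE opprB opprK addrC.
Qed.

Lemma bar_sum (I : Type) (r : seq I) (P : pred I) (F : I -> laurent) :
  bar (\sum_(i <- r | P i) F i) = \sum_(i <- r | P i) bar (F i).
Proof. exact: (big_morph bar barD bar0). Qed.

Lemma invuE : u^-1 = lmon (- 1).
Proof.
apply: (mulrI u_unit); rewrite divrr ?u_unit // /u lmonD subrr.
by apply: laurentP => k; rewrite !lmonE.
Qed.

Lemma bar_u : bar u = u^-1.
Proof. by rewrite invuE; apply: laurentP => k; rewrite barE !lmonE eqr_oppLR. Qed.

Lemma bar_alpha : bar alpha = - alpha.
Proof. by rewrite /alpha barD barN -bar_u barK opprB. Qed.

Definition sgn (k : int) : laurent := (- 1) ^ k.

Lemma sgnD j k : sgn (j + k) = sgn j * sgn k.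
Proof. by rewrite /sgn exprzDr // unitrN1. Qed.

Lemma exprN1z (R : unitRingType) (k : int) : (- 1 : R) ^ k = (- 1) ^+ odd `|k|%N.
Proof.
case: k => n; first by rewrite -exprnP signr_odd.
by rewrite /exprz /absz -[in LHS]signr_odd; case: (odd _); rewrite /= ?expr1 ?invrN1 ?expr0 ?invr1.
Qed.

Lemma sgn_cases k : sgn k = 1 \/ sgn k = - 1.
Proof. by rewrite /sgn exprN1z; case: odd; [right; rewrite /= expr1|left; rewrite /= expr0]. Qed.

Lemma sgn_sq k : sgn k * sgn k = 1.
Proof. by case: (sgn_cases k) => ->; rewrite ?mulrNN mulr1. Qed.

Lemma sgnS k : sgn (k + 1) = - sgn k.
Proof. by rewrite sgnD /sgn expr1z mulrN1. Qed.

Lemma sgn0 : sgn 0 = 1.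
Proof. exact: expr0z. Qed.

Lemma bar_sgn k : bar (sgn k) = sgn k.
Proof. by case: (sgn_cases k) => ->; rewrite ?barN bar1. Qed.

Lemma in_negD f g : in_neg f -> in_neg g -> in_neg (f + g).
Proof. by move=> hf hg k k0; rewrite lcoefD hf // hg. Qed.

Lemma in_negN f : in_neg f -> in_neg (- f).
Proof. by move=> hf k k0; rewrite lcoefN hf // oppr0. Qed.

Lemma in_neg0 : in_neg 0.
Proof. by move=> k _; rewrite lcoef0. Qed.

Lemma in_neg_sum (I : eqType) (r : seq I) (F : I -> laurent) :
  (forall i, i \in r -> in_neg (F i)) -> in_neg (\sum_(i <- r) F i).
Proof.
elim: r => [|i r IH] h; first by rewrite big_nil; apply: in_neg0.
rewrite big_cons; apply: in_negD; first by apply: h; rewrite mem_head.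
by apply: IH => j jr; apply: h; rewrite inE jr orbT.
Qed.

Lemma in_negM f g : in_neg f -> in_neg g -> in_neg (f * g).
Proof.
move=> hf hg k k0; rewrite lcoefM big1 // => i _.
have [i0|i0] := leP 0 i; first by rewrite hf ?mul0r.
by rewrite [X in _ * X]hg ?mulr0 //; lia.
Qed.

Lemma in_neg_sgn k f : in_neg f -> in_neg (sgn k * f).
Proof.
by case: (sgn_cases k) => -> h; rewrite ?mul1r // mulN1r; apply: in_negN.
Qed.

Lemma in_neg_bar_eq0 f : in_neg f -> bar f = f -> f = 0.
Proof.
move=> hf fb; apply: laurentP => k; rewrite lcoef0.
have [k0|k0] := leP 0 k; first exact: hf.
by rewrite -fb barE hf //; lia.
Qed.

Lemma u_exprzD j k : u ^ (j + k) = u ^ j * u ^ k.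
Proof. by rewrite exprzDr // u_unit. Qed.

Lemma lmon0 : lmon 0 = 1.
Proof. by apply: laurentP => k; rewrite !lmonE. Qed.

Lemma psubst_u2E (p : {poly int}) k :
  lcoef (psubst (u ^+ 2) p) (k%:Z * 2) = p`_k.
Proof.
have un n : (u ^+ 2) ^+ n = lmon (n%:Z * 2).
  elim: n => [|n IH]; first by rewrite expr0 mul0r lmon0.
  by rewrite exprS IH expr2 /u !lmonD; congr lmon; lia.
have ci (n : int) j : lcoef (n%:~R : laurent) j = n * (j == 0)%:R.
  have cn (m : nat) : lcoef (m%:R : laurent) j = m%:R * (j == 0)%:R.
    elim: m => [|m IH]; first by rewrite lcoef0 mul0r.
    by rewrite -natr1 lcoefD IH lcoef1 -natr1 mulrDl mul1r.
  case: n => m; first by rewrite -pmulrn cn -[RHS]/(m%:Z * _) natz.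
  by rewrite NegzE mulrNz lcoefN -pmulrn cn mulNr natz.
rewrite /psubst horner_coef; set P := map_poly _ p.
have cP i : P`_i = (p`_i)%:~R by rewrite coef_map.
have -> : lcoef (\sum_(i < size P) P`_i * (u ^+ 2) ^+ i) (k%:Z * 2) =
   \sum_(i < size P) lcoef (P`_i * (u ^+ 2) ^+ i) (k%:Z * 2).
  by apply: (big_morph (fun f => lcoef f _)) => [f g|]; rewrite ?lcoefD ?lcoef0.
have t (i : nat) : lcoef (P`_i * (u ^+ 2) ^+ i) (k%:Z * 2) = (i == k)%:R * p`_i.
  rewrite un mulrC lmonM cP ci mulrC; congr (_%:R * _).
  by congr nat_of_bool; apply/eqP/eqP; lia.
have [h|h] := ltnP k (size P).
  rewrite (bigD1 (Ordinal h)) //= t eqxx mul1r big1 ?addr0 // => i ik.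
  rewrite t; case: (eqVneq (i : nat) k) => [e|_]; last by rewrite mul0r.
  by case/eqP: ik; apply: val_inj.
rewrite big1 => [|i _]; last first.
  by rewrite t; case: eqP => [e|]; rewrite ?mul0r //; move: (ltn_ord i); rewrite e ltnNge h.
have : P`_k = 0 by rewrite nth_default.
by rewrite cP => /(congr1 (lcoef^~ 0)); rewrite /= ci lcoef0 eqxx mulr1.
Qed.

Lemma psubst_u2_inj : injective (psubst (u ^+ 2)).
Proof. by move=> p q h; apply/polyP => k; rewrite -!psubst_u2E h. Qed.

Lemma psubstM x p q : psubst x (p * q) = psubst x p * psubst x q.
Proof. by rewrite /psubst rmorphM hornerM. Qed.

Lemma psubst0 x : psubst x 0 = 0.
Proof. by rewrite /psubst rmorph0 horner0. Qed.

Lemma psubst1 x : psubst x 1 = 1.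
Proof. by rewrite /psubst rmorph1 hornerC. Qed.

Lemma psubst_sgn x k : psubst x ((- 1) ^ k) = sgn k.
Proof.
rewrite /sgn !exprN1z; case: odd; rewrite ?expr0 ?expr1 ?psubst1 //.
by rewrite /psubst rmorphN rmorph1 hornerN hornerC.
Qed.

Lemma psubst_sum x (I : Type) (q : seq I) (F : I -> {poly int}) :
  psubst x (\sum_(i <- q) F i) = \sum_(i <- q) psubst x (F i).
Proof. by apply: (big_morph _ _ (psubst0 x)) => p1 p2; rewrite /psubst rmorphD hornerD. Qed.

End LaurentFacts.

(** * The extension and its twisted order *)

Section HatGroup.
Variables (S Sh : finType) (W Wh : groupType).
Variables (C : coxeter_system S W) (Ch : coxeter_system Sh Wh).
Variable E : hat_extension C Ch.
Local Open Scope group_scope.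
Local Notation e := (emb E).
Local Notation len := (len Ch).
Local Notation refl := (reflections Ch).
Implicit Types (x y t a : Wh) (s : Sh).

Definition hatJ : {set Sh} := [set inc E s | s : S].
Local Notation par := (parabolic Ch hatJ).
Local Notation minc := (mincoset Ch hatJ).

Lemma emb1 : e 1 = 1.
Proof. by apply: (mulgI (e 1)); rewrite -emb_mul !mulg1. Qed.

Lemma embV (x : W) : e x^-1 = (e x)^-1.
Proof. by apply: (mulgI (e x)); rewrite -emb_mul !mulgV emb1. Qed.

Lemma emb_wprod (w : seq S) : e (wprod C w) = wprod Ch (map (inc E) w).
Proof.
by elim: w => [|s w IH]; rewrite ?wprod_nil ?emb1 //= !wprod_cons emb_mul emb_gen IH.
Qed.

Lemma emb_parI (I : {set S}) x :
  parabolic Ch [set inc E s | s in I] x <-> exists2 y, parabolic C I y & x = e y.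
Proof.
split=> [[w hw ->]|[_ [w hw ->] ->]].
  have [v hv ev] : exists2 v : seq S, all (mem I) v & w = map (inc E) v.
    elim: w hw => [_|s w IH /= /andP[/imsetP[r rI ->] /IH[v hv ->]]]; first by exists [::].
    by exists (r :: v) => //=; rewrite rI.
  by exists (wprod C v); [exists v | rewrite emb_wprod -ev].
exists (map (inc E) w); last exact: emb_wprod.
rewrite all_map; apply: sub_all hw => s /= sI; apply/imsetP; by exists s.
Qed.

Lemma emb_par x : par x <-> exists y : W, x = e y.
Proof.
have := emb_parI [set: S] x; have -> : [set inc E s | s in [set: S]] = hatJ.
  by apply/setP => s; apply/imsetP/imsetP => -[r _ ->]; exists r.
move=> ->; split=> [[y _ ->]|[y ->]]; exists y => //.
by exists (rword C y); [apply/allP => s; rewrite /= inE | rewrite -/(wprod C _) rwordE].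
Qed.

Lemma par_emb (y : W) : par (e y).
Proof. by apply/emb_par; exists y. Qed.

Lemma len_emb (y : W) : len (e y) = Defs.len C y.
Proof.
apply/eqP; rewrite eqn_leq; apply/andP; split.
  rewrite -(size_rword C y) -{1}(rwordE C y) emb_wprod -(size_map (inc E) (rword C y)).
  exact: len_wprod.
have [w [hw ew <-]] := par_rword (par_emb y).
have [v hv] : exists v : seq S, w = map (inc E) v.
  elim: w hw {ew} => [_|s w IH /= /andP[/imsetP[r rI ->] /IH[v ->]]]; first by exists [::].
  by exists (r :: v).
move: ew; rewrite hv -emb_wprod => /(emb_inj (h := E)) ->; rewrite size_map.
exact: len_wprod.
Qed.

Lemma refls_emb (w : seq S) : refls Ch (map (inc E) w) = map e (refls C w).
Proof.
elim: w => //= s w IH; rewrite IH emb_gen -!map_comp; congr (_ :: _).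
by apply: eq_map => t /=; rewrite !emb_mul emb_gen.
Qed.

Lemma invb_emb (y t : W) : invb Ch (e y) (e t) = invb C y t.
Proof.
rewrite -(rwordE C y) emb_wprod !invb_wprod /rpar refls_emb count_map.
by congr odd; apply: eq_count => t' /=; rewrite (inj_eq (@emb_inj _ _ _ _ _ _ E)).
Qed.

Lemma inversionsE x t : inversions Ch x t <-> invb Ch x t.
Proof.
split=> [[rt /bruhat_len h]|h].
  rewrite -ltn_lenr //; move: h; have := ltn_lenrN x rt; rewrite -ltn_lenr //.
  by lia.
by split; [apply: invb_refl h | apply: bruhat_step].
Qed.

Lemma range_par t : range e t <-> par t.
Proof. by rewrite emb_par; split=> [[y _ <-]|[y ->]]; exists y. Qed.

Lemma card_invb (B : set Wh) (r : seq Wh) x : uniq r ->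
  (forall t, (invb Ch x^-1 t /\ B t) <-> t \in r) ->
  twlen Ch B x = ((len x)%:Z - 2 * (size r)%:Z)%R.
Proof.
move=> ur h; rewrite /twlen; congr (_ - 2 * Posz _)%R.
apply: card_fset_set_seq => // t; rewrite -h.
by split=> -[/inversionsE].
Qed.

Lemma twlen_A x w : minc x -> par w ->
  twlen Ch (Aset E) (x * w) = ((len w)%:Z - (len x)%:Z)%R.
Proof.
move=> hx hw; pose q := rword Ch x^-1.
have ur : uniq [seq w^-1 * t * w | t <- refls Ch q].
  rewrite map_inj_uniq ?refls_uniq ?rwordE ?size_rword // => t t' /mulIg /mulgI //.
have hq t : (t \in refls Ch q) = invb Ch x^-1 t by rewrite mem_refls ?rwordE ?size_rword.
rewrite (card_invb ur) => [|t].
  by rewrite size_map size_refls size_rword lenV (mincoset_add hx hw); lia.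
have wt : w^-1 * (w * t * w^-1) * w = t by rewrite !mulgA mulVg mul1g mulgKV.
split=> [[h [rt nr]]|/mapP[t' + et]].
  have np : ~ par t by move=> /range_par.
  by apply/mapP; exists (w * t * w^-1) => //; rewrite hq -(mincoset_invb_npar x hw np).
rewrite hq => h; have et' : t' = w * t * w^-1 by rewrite et !mulgA mulgV mul1g mulgK.
have np : ~ par t by move=> /(parJ t hw); rewrite -et' => /hx/negP.
have h2 : invb Ch (x * w)^-1 t by rewrite (mincoset_invb_npar x hw np) -et'.
by split=> //; split; [apply: invb_refl h2 | move=> /range_par].
Qed.

Lemma twlen_Ac x w : minc x -> par w ->
  twlen Ch (Acompl E) (x * w) = ((len x)%:Z - (len w)%:Z)%R.
Proof.
move=> hx hw; have ur : uniq (refls Ch (rword Ch w^-1)).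
  by rewrite refls_uniq ?rwordE ?size_rword.
rewrite (card_invb ur) => [|t].
  by rewrite size_refls size_rword lenV (mincoset_add hx hw); lia.
rewrite mem_refls ?rwordE ?size_rword //; split=> [[h [rt /range_par pt]]|h].
  by rewrite -(mincoset_invb_par hx).
have pt : par t by apply: par_invb h; apply: parV.
rewrite (mincoset_invb_par hx) //; split=> //.
by split; [apply: invb_refl h | apply/range_par].
Qed.

Lemma twlen_AcE x : twlen Ch (Acompl E) x = (- twlen Ch (Aset E) x)%R.
Proof.
by have [a [w [ha hw ->]]] := coset_decomp Ch hatJ x; rewrite twlen_A // twlen_Ac //; lia.
Qed.

Local Notation lA := (twlen Ch (Aset E)).

Definition posA x t : bool := invb Ch x^-1 t (+) `[< par t >].

Lemma posA_mulr x t : refl t -> posA (x * t) t = ~~ posA x t.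
Proof.
move=> rt; rewrite /posA invgM (reflV rt) invbM invb_self // mulVg mul1g.
by rewrite addTb; case: (invb Ch _ _); case: asboolP.
Qed.

Lemma posA_lt x t : refl t -> posA x t -> (lA x < lA (x * t)%g)%R.
Proof.
move=> rt; have [a [w [ha hw ->]]] := coset_decomp Ch hatJ x.
rewrite /posA; case: asboolP => [pt|npt] /=.
  rewrite (mincoset_invb_par ha hw pt) addbT -ltn_lenrrN // => h.
  have -> : a * w * t = a * (w * t) by rewrite mulgA.
  by rewrite !twlen_A //; [lia | apply: parM].
rewrite (mincoset_invb_npar a hw npt) addbF -ltn_lenrr; last exact: reflJ.
move: (w * t * w^-1) (mulgKV w (w * t)) => t1 et.
have -> : a * w * t = a * t1 * w by rewrite -mulgA -et mulgA.
have [b [v [hb hv ->]]] := coset_decomp Ch hatJ (a * t1).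
have -> : b * v * w = b * (v * w) by rewrite mulgA.
rewrite (mincoset_add hb) // !twlen_A //; last exact: parM.
have := lenM Ch v^-1 (v * w); rewrite mulKg lenV.
by lia.
Qed.

Lemma lA_lt x t : refl t -> (lA x < lA (x * t)%g)%R = posA x t.
Proof.
move=> rt; apply/idP/idP => [|/(posA_lt rt)//]; apply: contraLR.
rewrite -posA_mulr // => /(posA_lt rt); rewrite -mulgA (reflP rt) mulg1.
by lia.
Qed.

Lemma lA_ltl x t : refl t -> (lA x < lA (t * x)%g)%R = posA x (x^-1 * t * x).
Proof. by move=> rt; rewrite -lA_lt ?mulgA ?mulgV ?mul1g //; apply: reflJV. Qed.

Lemma lA_gen s x : lA (gen Ch s * x) <> lA x.
Proof.
have h := lA_ltl x (refl_gen Ch s); have h' := lA_ltl (gen Ch s * x) (refl_gen Ch s).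
rewrite genK in h'; move: h'; have -> : gen Ch s * x = x * (x^-1 * gen Ch s * x).
  by rewrite !mulgA mulgV mul1g.
set t := x^-1 * _ * x in h *; have rt : refl t by apply/reflJV/refl_gen.
have -> : (x * t)^-1 * gen Ch s * (x * t) = t.
  transitivity (t^-1 * (x^-1 * gen Ch s * x) * t); first by rewrite invgM !mulgA.
  by rewrite -/t mulVg mul1g.
by rewrite posA_mulr // -lA_lt //; lia.
Qed.

Lemma lA_key s t x : refl t -> t <> gen Ch s ->
  (lA x < lA (t * x)%g -> lA (gen Ch s * x)%g < lA (gen Ch s * (t * x))%g)%R.
Proof.
move=> rt nt; rewrite lA_ltl //; set t1 := x^-1 * t * x => h.
have rt1 : refl t1 by apply: reflJV.
have -> : gen Ch s * (t * x) = (gen Ch s * x) * t1.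
  by rewrite /t1 -!mulgA (mulgA x) mulgV mul1g.
rewrite lA_lt // /posA invgM invbM genV invb_gen invgK.
have -> : x * t1 * x^-1 = t by rewrite /t1 !mulgA mulgV mul1g mulgK.
by case: eqP => // _; rewrite addbF.
Qed.

Local Notation leA := (twle Ch (Aset E)).

Lemma leA_genE s x : leA (gen Ch s * x) x <-> (lA (gen Ch s * x)%g < lA x)%R.
Proof. exact: (ro_genE lA_gen). Qed.

Lemma leA_dd s x y : leA x y -> (lA (gen Ch s * x)%g < lA x)%R ->
  (lA (gen Ch s * y)%g < lA y)%R -> leA (gen Ch s * x) (gen Ch s * y).
Proof. exact: (ro_dd lA_gen lA_key). Qed.

Lemma leA_uu s x y : leA x y -> (lA x < lA (gen Ch s * x)%g)%R ->
  (lA y < lA (gen Ch s * y)%g)%R -> leA (gen Ch s * x) (gen Ch s * y).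
Proof. exact: (ro_uu lA_gen lA_key). Qed.

Lemma leA_trans y x z : leA x y -> leA y z -> leA x z.
Proof. exact: ro_trans. Qed.

Lemma leA_gen s x : (lA x < lA (gen Ch s * x)%g)%R -> leA x (gen Ch s * x).
Proof. exact: ro_genW. Qed.

Lemma leA_stepr x t : refl t -> posA x t -> leA x (x * t).
Proof.
move=> rt h; have -> : x * t = (x * t * x^-1) * x by rewrite mulgKV.
by apply: ro_step; [apply: reflJ | rewrite mulgKV lA_lt].
Qed.

Lemma leA_ind_step (P : Wh -> Wh -> Prop) :
  (forall x, P x x) -> (forall x y z, P x y -> P y z -> P x z) ->
  (forall x t, refl t -> posA x t -> P x (x * t)) ->
  forall x y, leA x y -> P x y.
Proof.
move=> P1 PT PS x y; elim=> {x y} //; last by move=> x y z _ h _; apply: PT h.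
move=> x y [t rt [-> h]].
have -> : t * x = x * (x^-1 * t * x) by rewrite !mulgA mulgV mul1g.
by apply: PS; [apply: reflJV | rewrite -lA_ltl].
Qed.

Lemma twle_Ac x y : twle Ch (Acompl E) x y <-> leA y x.
Proof.
split; elim=> {x y}.
- move=> x y [t rt [-> h]]; have e1 : t * (t * x) = x by rewrite mulgA (reflP rt) mul1g.
  by rewrite -{2}e1; apply: ro_step rt _; rewrite e1; move: h; rewrite !twlen_AcE; lia.
- by move=> x; apply: ro_refl.
- by move=> x y z _ h1 _ h2; apply: ro_trans h2 h1.
- move=> x y [t rt [-> h]]; have e1 : t * (t * x) = x by rewrite mulgA (reflP rt) mul1g.
  by rewrite -{2}e1; apply: ro_step rt _; rewrite e1 !twlen_AcE; lia.
- by move=> x; apply: ro_refl.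
by move=> x y z _ h1 _ h2; apply: ro_trans h2 h1.
Qed.

Lemma twdesc_A s x : twdesc Ch (Aset E) x s <-> (lA (gen Ch s * x)%g < lA x)%R.
Proof. exact: leA_genE. Qed.

Lemma twdesc_Ac s x : twdesc Ch (Acompl E) x s <-> (lA x < lA (gen Ch s * x)%g)%R.
Proof.
rewrite /twdesc /= twle_Ac -{1}(genK Ch s x) leA_genE genK.
by [].
Qed.

End HatGroup.

Section TwistedRecursion.
Variables (S Sh : finType) (W Wh : groupType).
Variables (C : coxeter_system S W) (Ch : coxeter_system Sh Wh).
Variable E : hat_extension C Ch.
Local Open Scope ring_scope.
Local Notation lA := (twlen Ch (Aset E)).
Local Notation leA := (twle Ch (Aset E)).
Implicit Types (x y : Wh) (s : Sh).

Definition is_Qrec (Q : Wh -> Wh -> laurent) : Prop :=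
  [/\ Q 1%g 1%g = 1, forall x y, ~ leA x y -> Q x y = 0
    & forall s x y, lA x < lA (gen Ch s * x)%g ->
        Q x y = Q (gen Ch s * x)%g (gen Ch s * y)%g
        + (if lA (gen Ch s * y)%g < lA y then bar alpha * Q (gen Ch s * x)%g y else 0)].

Lemma twR_A_Qrec R : is_twR Ch (Aset E) R -> is_Qrec R.
Proof.
move=> [R1 R0 _ Rrec]; split=> // s x y.
have col a d : lA (gen Ch s * d)%g < lA d ->
    R a d = R (gen Ch s * a)%g (gen Ch s * d)%g
      + (if lA a < lA (gen Ch s * a)%g then bar alpha * R a (gen Ch s * d)%g else 0).
  move=> hd; have ld : leA (gen Ch s * d) d by apply/leA_genE.
  case: (pselect (leA a d)) => [lad|nad].
    have [h1 h2] := Rrec a d s lad (iffRL (twdesc_A _ _ _) hd).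
    have := @lA_gen _ _ _ _ _ _ E s a; case: ltP => ha na.
      by apply: h2 => /twdesc_A; lia.
    by rewrite addr0; apply: h1; apply/twdesc_A; lia.
  rewrite (R0 a d nad) (R0 (gen Ch s * a)%g); last first.
    move=> h; have := @lA_gen _ _ _ _ _ _ E s a => na.
    case: (ltP (lA a) (lA (gen Ch s * a)%g)) => ha.
      by apply: nad; apply: leA_trans (leA_trans (leA_gen ha) h) ld.
    by have := leA_uu (s := s) h; rewrite !genK => h'; apply: nad; apply: h'; rewrite ?genK; lia.
  rewrite R0 ?mulr0 ?if_same ?addr0 // => h; apply: nad.
  exact: leA_trans h ld.
move=> hx; have := @lA_gen _ _ _ _ _ _ E s y; case: ltP => hy ny.
  rewrite (col x y hy) hx (col (gen Ch s * x)%g y hy) genK ifF ?addr0 //; lia.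
rewrite (col (gen Ch s * x)%g (gen Ch s * y)%g) ?genK; last by lia.
by rewrite ifF ?addr0 //; lia.
Qed.

Lemma twR_Ac_Qrec R : is_twR Ch (Acompl E) R -> is_Qrec (fun x y => R y x).
Proof.
move=> [R1 R0 _ Rrec]; split=> // [x y h|s x y hx]; first by apply: R0 => /twle_Ac.
have ny := @lA_gen _ _ _ _ _ _ E s y.
have lx : leA x (gen Ch s * x) by apply: leA_gen.
case: (pselect (leA x y)) => [lxy|nxy].
  have [h1 h2] := Rrec y x s (iffRL (twle_Ac _ _ _) lxy) (iffRL (twdesc_Ac _ _ _) hx).
  case: ltP => hy.
    by apply: h2 => /twdesc_Ac; lia.
  by rewrite addr0; apply: h1; apply/twdesc_Ac; lia.
have R0' a d : ~ leA d a -> R a d = 0 by move=> h; apply: R0 => /twle_Ac.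
rewrite !R0' ?mulr0 ?if_same ?addr0 // => h; apply: nxy.
  exact: leA_trans h.
case: (ltP (lA (gen Ch s * y)%g) (lA y)) => hy.
  by apply: leA_trans (leA_trans lx h) _; apply/leA_genE.
by have := leA_dd (s := s) h; rewrite !genK; apply; lia.
Qed.

Lemma lA_gen_pm s x : lA (gen Ch s * x)%g = lA x + 1 \/ lA (gen Ch s * x)%g = lA x - 1.
Proof.
have [a [w [ha hw ->]]] := coset_decomp Ch (hatJ E) x.
have e1 : (gen Ch s * (a * w) = gen Ch s * a * w)%g by rewrite mulgA.
case: (mincoset_left s ha) => [hsa|[q qJ ea]].
  rewrite e1 !(twlen_A _ hw) //; have := len_genl Ch s a.
  by case: ifP => _; [left|right]; lia.
have -> : (gen Ch s * (a * w) = a * (gen Ch q * w))%g by rewrite e1 ea mulgA.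
rewrite !(twlen_A ha) //; last by apply: parM => //; apply: par_gen.
have := len_genl Ch q w.
by case: ifP => _; [right|left]; lia.
Qed.

Lemma Qrec_bar Q : is_Qrec Q -> is_Qrec (fun x y => sgn (lA x - lA y) * bar (Q x y)).
Proof.
move=> [Q1 Q0 Qr]; split=> [|x y h|s x y hx].
- by rewrite Q1 subrr sgn0 bar1 mul1r.
- by rewrite Q0 // bar0 mulr0.
rewrite (Qr s x y hx) barD mulrDr.
have ex : lA (gen Ch s * x)%g = lA x + 1 by case: (lA_gen_pm s x); lia.
have sgn2 k : sgn (k + 1 + 1) = sgn k by rewrite !sgnS opprK.
congr (_ + _); last first.
  case: ifP => _; last by rewrite bar0 mulr0.
  rewrite ex (_ : lA x + 1 - lA y = lA x - lA y + 1); last by lia.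
  by rewrite barM barK sgnS bar_alpha !mulNr mulrN opprK mulrCA.
congr (_ * _); rewrite ex; case: (lA_gen_pm s y) => ->.
  by congr sgn; lia.
by rewrite -sgn2; congr sgn; lia.
Qed.

Lemma Qrec_col Q s x y : is_Qrec Q -> lA y < lA (gen Ch s * y)%g ->
  Q x (gen Ch s * y)%g = Q (gen Ch s * x)%g y
     + (if lA x < lA (gen Ch s * x)%g then bar alpha * Q x y else 0).
Proof.
move=> [_ _ Qr] hy; have nx := @lA_gen _ _ _ _ _ _ E s x.
case: ltP => hx.
  rewrite (Qr s x _ hx) (Qr s x y hx) !genK hy ifF ?addr0; last by lia.
  by [].
rewrite (Qr s (gen Ch s * x)%g y) !genK ?ifF ?addr0 //; lia.
Qed.

End TwistedRecursion.

(** * Supports and double cosets *)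

Section GeneratorSupport.
Variables (S : finType) (W : groupType) (C : coxeter_system S W).
Local Open Scope group_scope.

Lemma par_genE (I : {set S}) s : parabolic C I (gen C s) <-> s \in I.
Proof.
split=> [/par_rword[w [hw ew]]|]; last exact: par_gen.
rewrite len_gen; case: w hw ew => [|r [|]] //= /andP[rI _].
by rewrite wprod_cons wprod_nil mulg1 => /gen_inj ->.
Qed.

Lemma par_disjoint (I J : {set S}) x : [disjoint I & J] ->
  parabolic C I x -> parabolic C J x -> x = 1.
Proof.
move=> dIJ pI pJ; have [[|s w] [/= hw ew hs]] := par_rword pI; first by rewrite ew wprod_nil.
case/andP: hw => sI _; have : invb C x (gen C s).
  rewrite -ltn_lenr; last exact: refl_gen.
  by rewrite -hs ew wprod_cons genK ltnS len_wprod.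
move=> /(par_invb pJ)/par_genE sJ.
by have := disjointFr dIJ sI; rewrite sJ.
Qed.

Lemma len_uniq (w : seq S) : uniq w -> len C (wprod C w) = size w.
Proof.
elim: w => [|s w IH] /=; first by rewrite wprod_nil len1.
move=> /andP[sw uw]; rewrite wprod_cons; have := len_genl C s (wprod C w).
rewrite IH //; case: ifP => // h _; case/negP: sw.
have p : parabolic C [set t in w] (wprod C w).
  by exists w => //; apply/allP => t; rewrite /= inE.
by have /par_genE := par_invb p h; rewrite inE.
Qed.

Lemma par_letters (I : {set S}) (w : seq S) : len C (wprod C w) = size w ->
  parabolic C I (wprod C w) -> all (mem I) w.
Proof.
elim: w => //= s w IH; rewrite wprod_cons => hl p.
have hw : len C (wprod C w) = size w.
  by have := lenM C (gen C s) (wprod C w); have := len_wprod C w; rewrite len_gen; lia.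
have ps : parabolic C I (gen C s).
  apply: par_invb p _; rewrite -ltn_lenr; last exact: refl_gen.
  by rewrite genK hl hw.
rewrite IH ?andbT //; first exact/par_genE.
by apply/(parMl _ ps).
Qed.

Lemma mincoset_disjoint (I J : {set S}) x : [disjoint I & J] ->
  parabolic C J x -> mincoset C I x.
Proof.
move=> dIJ px t pt; apply/negP => h.
have t1 := par_disjoint dIJ pt (par_invb (parV px) h).
by move: (invb_self (invb_refl h)); rewrite t1 invb1.
Qed.

(* [c1] is the part of [c] that survives in the Demazure product of [b] and [c]. *)
Lemma demazure_part (J : {set S}) a b c : mincoset C J a -> parabolic C J c ->
  exists c1, [/\ parabolic C J c1, len C (b * c1) = (len C b + len C c1)%N,
                 bruhat C (b * c) (b * c1) & bruhat C (a * c1) (a * c)].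
Proof.
move=> ha /parV/par_rword[v [hv ev hl]]; rewrite ev in hl.
rewrite -(invgK c) ev {c ev}.
elim: v hv hl => [|s v IH] /=.
  move=> _ _; exists 1; rewrite wprod_nil invg1 !mulg1 len1 addn0.
  by split=> //; [apply: par1 | apply: bruhat_refl | apply: bruhat_refl].
rewrite wprod_cons => /andP[sJ hv] hl.
have hv' : size v = len C (wprod C v).
  by have := lenM C (gen C s) (wprod C v); have := len_wprod C v; rewrite len_gen; lia.
have [c1 [pc1 l1 b1 b2]] := IH hv hv'.
rewrite invgM genV; set c := (wprod C v)^-1 in b1 b2 *.
have pc : parabolic C J c by apply: parV; exists v.
have hac : len C (a * c) < len C (a * c * gen C s).
  have -> : a * c * gen C s = a * (c * gen C s) by rewrite mulgA.
  rewrite !(mincoset_add ha) //; last by apply: parM => //; apply: par_gen.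
  have -> : c * gen C s = (gen C s * wprod C v)^-1 by rewrite invgM genV.
  by rewrite !lenV -hl -hv'; lia.
rewrite !mulgA; have := len_genr C s (b * c1); case: ifP => _ h.
  exists c1; split=> //.
    have := len_genr C s (b * c); case: ifP => [h1|_] h2.
      by apply: bruhat_trans b1; apply: bruhat_stepr.
    by apply: bruhat_liftr => //; rewrite ?h2 ?h.
  by apply: bruhat_trans b2 _; apply: bruhat_genr.
exists (c1 * gen C s); rewrite !mulgA; split.
- by apply: parM => //; apply: par_gen.
- have := lenM C b (c1 * gen C s); have := lenM C c1 (gen C s); rewrite len_gen.
  have -> : b * (c1 * gen C s) = b * c1 * gen C s by rewrite mulgA.
  by rewrite h; lia.
- by apply: bruhat_mulr => //; rewrite h.
exact: bruhat_mulr.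
Qed.

End GeneratorSupport.

Section DoubleCosets.
Variables (S Sh : finType) (W Wh : groupType).
Variables (C : coxeter_system S W) (Ch : coxeter_system Sh Wh).
Variable E : hat_extension C Ch.
Variables (r : seq S) (r_uniq : uniq r) (r_enum : forall s : S, s \in r).
Local Open Scope group_scope.
Local Notation e := (emb E).
Local Notation hJ := (hatJ E).
Local Notation par := (parabolic Ch hJ).
Local Notation minc := (mincoset Ch hJ).
Local Notation lA := (twlen Ch (Aset E)).
Local Notation leA := (twle Ch (Aset E)).
Local Notation z := (zI E r).
Local Notation th s := (gen Ch (theta E s)).
Local Notation gh s := (gen Ch (inc E s)).

Definition hatK : {set Sh} := [set theta E s | s : S].

Lemma hatJK : [disjoint hJ & hatK].
Proof.
apply/pred0P => s /=; apply/negbTE/negP => /andP[/imsetP[t _ ->] /imsetP[t' _ h]].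
by have := theta_im E (inc E t); rewrite {1}h !codom_f.
Qed.

Lemma theta_commute s t : s != t -> commute (th s) (gh t).
Proof.
move=> st; apply: commute_sym; apply: contrapT => /(theta_comm E) h.
by rewrite h eqxx in st.
Qed.

Lemma theta_ncommute s : ~ commute (th s) (gh s).
Proof. by move=> /commute_sym; apply/(theta_comm E). Qed.

Definition zword (I : {set S}) : seq Sh := [seq theta E s | s <- r & s \notin I].

Lemma zIE I : z I = wprod Ch (zword I).
Proof. by rewrite /zI /wprod big_map big_filter. Qed.

Lemma zword_uniq I : uniq (zword I).
Proof. by rewrite map_inj_uniq ?filter_uniq //; apply: theta_inj. Qed.

Lemma size_zword I : size (zword I) = (#|S| - #|I|)%N.
Proof.
have -> : (#|S| - #|I|)%N = #|~: I| by rewrite [RHS]cardsCs finset.setCK.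
rewrite size_map cardE; apply: perm_size; apply: uniq_perm.
- exact: filter_uniq.
- exact: enum_uniq.
by move=> s; rewrite mem_filter mem_enum inE r_enum andbT.
Qed.

Lemma len_zI I : len Ch (z I) = (#|S| - #|I|)%N.
Proof. by rewrite zIE (len_uniq _ (zword_uniq I)) size_zword. Qed.

Lemma parK_zI I : parabolic Ch hatK (z I).
Proof.
rewrite zIE; exists (zword I) => //; apply/allP => s /mapP[t _ ->] /=.
by apply/imsetP; exists t.
Qed.

Lemma minc_K x : parabolic Ch hatK x -> minc x.
Proof. exact: mincoset_disjoint hatJK. Qed.

Lemma invb_K_par x t : parabolic Ch hatK x -> par t -> invb Ch x t = false.
Proof.
move=> px pt; apply: negbTE; rewrite -(invgK x); apply: minc_K pt.
exact: parV.
Qed.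

Lemma len_mul_K p x : par p -> parabolic Ch hatK x ->
  len Ch (p * x) = (len Ch p + len Ch x)%N.
Proof.
move=> pp /parV/minc_K h; rewrite -lenV invgM (mincoset_add h (parV pp)) !lenV.
by rewrite addnC.
Qed.

Lemma zI_inj : injective z.
Proof.
suff sub I J : z I = z J -> I \subset J.
  by move=> I J h; apply/eqP; rewrite finset.eqEsubset !sub.
move=> h; have : all (mem [set s in zword I]) (zword J).
  have pJ : parabolic Ch [set s in zword I] (wprod Ch (zword J)).
    rewrite -zIE -h zIE; exists (zword I) => //.
    by apply/allP => s; rewrite /= inE.
  exact: par_letters (len_uniq _ (zword_uniq J)) pJ.
move/allP => h2; apply/fintype.subsetP => s sI; apply: contraLR sI => sJ.
have /h2 : theta E s \in zword J by rewrite map_f // mem_filter sJ r_enum.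
by rewrite /= inE mem_map ?mem_filter; [case/andP | apply: theta_inj].
Qed.

Lemma theta_word_commute (w : seq S) s : s \notin w ->
  commute (gh s) (wprod Ch (map (theta E) w)).
Proof.
elim: w => [_|t w IH]; first by rewrite wprod_nil; apply: commute1.
rewrite inE negb_or eq_sym /= wprod_cons => /andP[st /IH]; apply: commuteM.
exact/commute_sym/theta_commute.
Qed.

Lemma zI_comm I x : parabolic C I x -> z I * e x = e x * z I.
Proof.
move=> [w hw ->]; elim: w hw => [_|s w IH /= /andP[sI /IH {}IH]].
  by rewrite big_nil emb1 mulg1 mul1g.
rewrite big_cons emb_mul -mulgA -IH !mulgA emb_gen; congr (_ * _).
by apply/esym; rewrite zIE; apply: theta_word_commute; rewrite mem_filter sI.
Qed.

(* Writing [z I = u * th s * v] with [s] commuting with [v], conjugation gives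
   [p * gh s = w * p] for [p = u * th s] and [w] in [W]; comparing lengths and
   supports forces [w = gh s], which contradicts the choice of [theta]. *)
Lemma zI_conj I s : par (z I * gh s * (z I)^-1) -> s \in I.
Proof.
move=> pw; apply/negPn/negP => sI.
have /splitPr es : s \in [seq s <- r | s \notin I] by rewrite mem_filter sI r_enum.
have : z I = wprod Ch (zword I) by apply: zIE.
have : uniq [seq s <- r | s \notin I] by apply: filter_uniq.
rewrite /zword; case: es => u v; rewrite cat_uniq /= negb_or.
case/and4P=> _ /andP[su _] sv _; rewrite -cat_rcons map_cat wprod_cat.
set p := wprod Ch (map (theta E) (rcons u s)); set q := wprod _ _ => ez.
have sq : gh s * q = q * gh s by apply: theta_word_commute.
have pK : parabolic Ch hatK p.
  by exists (map (theta E) (rcons u s)) => //; apply/allP => x /mapP[t _ ->];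
    apply/imsetP; exists t.
have sJ : inc E s \in hJ by apply/imsetP; exists s.
have ew : z I * gh s * (z I)^-1 = p * gh s * p^-1.
  by rewrite ez -(mulgA p) -sq invgM !mulgA mulgK.
rewrite ew in pw; set w := p * gh s * p^-1 in pw.
have lw : len Ch w = 1%N.
  have := len_mul_K pw pK; rewrite mulgKV (mincoset_gen (minc_K pK) sJ).
  by lia.
have [[|t [|? ?]] [/= hw e1 e2]] := par_rword pw; try by rewrite lw in e2.
rewrite wprod_cons wprod_nil mulg1 in e1.
have : parabolic Ch (inc E s |: hatK) (gen Ch t).
  rewrite -e1 /w; apply: parM; last apply: parV.
    apply: parM; last by apply: par_gen; rewrite !inE eqxx.
    by apply: par_sub pK; apply: finset.subsetUr.
  by apply: par_sub pK; apply: finset.subsetUr.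
move/par_genE; rewrite in_setU1 => /orP[/eqP et|tK]; last first.
  by move: hw; rewrite (disjointFl hatJK tK).
have := @theta_ncommute s; apply; rewrite /commute.
have : p * gh s = gh s * p by rewrite -{2}et -e1 mulgKV.
rewrite /p map_rcons -cats1 wprod_cat wprod_cons wprod_nil mulg1.
by rewrite (mulgA (gh s)) theta_word_commute // -!mulgA => /mulgI.
Qed.

Lemma invb_zI_conj I a t : mincoset C I a -> par t ->
  invb Ch (e a * z I)^-1 t -> invb Ch (e a)^-1 (z I * t * (z I)^-1).
Proof.
move=> ha pt; rewrite invgM invbM invgK (invb_K_par (parV (parK_zI I)) pt).
by [].
Qed.

Lemma minc_zI I a : mincoset C I a -> minc (e a * z I).
Proof.
move=> ha; apply: mincosetP => _ /imsetP[s _ ->].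
have ps : par (gh s) by apply: par_gen; apply/imsetP; exists s.
rewrite ltn_lenrrN; last exact: refl_gen.
apply/negP => /(invb_zI_conj ha ps) h.
have sI : s \in I.
  by apply: zI_conj; apply: par_invb h; apply: parV; apply: par_emb.
have := zI_comm (par_gen C sI); rewrite emb_gen => ez.
move: h; rewrite ez mulgK -emb_gen -embV invb_emb; apply/negP; apply: ha.
exact: par_gen.
Qed.

Lemma len_aI a I : len Ch (e a * z I) = (len C a + (#|S| - #|I|))%N.
Proof. by rewrite (len_mul_K (par_emb E a) (parK_zI I)) len_emb len_zI. Qed.

Local Notation V := (Vtype C).
Local Notation phi := (phi E r).
Implicit Types v w : V.

Lemma va_min v : mincoset C (vI v) (va v).
Proof. exact/minrepsP/vP. Qed.
Arguments va_min : clear implicits.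

Definition mkv I a b (h : mincoset C I a) : V := mkV b (introT (minrepsP C I a) h).

Lemma vext v w : vI v = vI w -> va v = va w -> vb v = vb w -> v = w.
Proof.
move=> h1 h2 h3; apply: val_inj; move: h1 h2 h3; rewrite /vI /va /vb.
by case: (val v) => [[? ?] ?]; case: (val w) => [[? ?] ?] /= -> -> ->.
Qed.

Lemma par_embV (y : W) : par (e y)^-1.
Proof. by apply: parV; apply: par_emb. Qed.

Lemma lA_phi v : lA (phi v) = (vdim v - #|S|%:Z)%R.
Proof.
rewrite /Defs.phi (twlen_A (minc_zI (va_min v)) (par_embV _)).
rewrite lenV len_emb len_aI /vdim; have : #|vI v| <= #|S| by apply: max_card.
by lia.
Qed.

Lemma phi_inj : injective phi.
Proof.
move=> v w h.
have [] := mincoset_uniq (minc_zI (va_min v)) (minc_zI (va_min w)) (par_embV _) (par_embV _) h.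
move=> ea /invg_inj /(@emb_inj _ _ _ _ _ _ E) eb.
have e1 : (e (va w))^-1 * e (va v) = z (vI w) * (z (vI v))^-1.
  by apply: (mulgI (e (va w))); apply: (mulIg (z (vI v))); rewrite !mulgA mulgV mul1g mulgKV.
have x1 : (e (va w))^-1 * e (va v) = 1.
  apply: (par_disjoint hatJK); first by apply: parM; [apply: par_embV | apply: par_emb].
  by rewrite e1; apply: parM; [|apply: parV]; apply: parK_zI.
apply: vext => //.
  apply: zI_inj; apply: (mulIg (z (vI v))^-1); rewrite mulgV -e1.
  exact: esym.
by apply: (@emb_inj _ _ _ _ _ _ E); apply: (mulgI (e (va w))^-1); rewrite x1 mulVg.
Qed.

Lemma phi_mkv I a b (h : mincoset C I a) : phi (mkv b h) = e a * z I * (e b)^-1.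
Proof. by []. Qed.

Lemma vact_inl s v :
  [\/ [/\ vI (vact (inl s) v) = vI v, va (vact (inl s) v) = gen C s * va v
        & vb (vact (inl s) v) = vb v]
    | exists t, [/\ t \in vI v, gen C s * va v = va v * gen C t,
        vI (vact (inl s) v) = vI v, va (vact (inl s) v) = va v
        & vb (vact (inl s) v) = vb v * gen C t]].
Proof.
rewrite /=; case: ifP => [h|nh].
  by left; rewrite /vI /va /vb insubdK.
right; case: pickP => [t /andP[tI /andP[_ /eqP ht]]|h]; first by exists t.
have [/minrepsP|[t tI ht]] := mincoset_left s (va_min v); first by rewrite nh.
have /negP[] := negbT (h t); rewrite tI ht eqxx andbT; apply/asboolP.
by apply: bruhat_genr; rewrite (mincoset_gen (va_min v)).
Qed.

Lemma phi_inl s v : phi (vact (inl s) v) = gh s * phi v.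
Proof.
rewrite /Defs.phi; case: (vact_inl s v) => [[-> -> ->]|[t [tI ht -> -> ->]]].
  by rewrite emb_mul emb_gen !mulgA.
have eh : gh s * e (va v) = e (va v) * gh t by rewrite -!emb_gen -!emb_mul ht.
have ez : z (vI v) * gh t = gh t * z (vI v) by rewrite -emb_gen; apply/zI_comm/par_gen.
by rewrite emb_mul emb_gen invgM genV !mulgA eh -(mulgA _ _ (gh t)) ez !mulgA.
Qed.

Lemma vle_trans v2 v1 v3 : vle v1 v2 -> vle v2 v3 -> vle v1 v3.
Proof. exact: rt_trans. Qed.

Lemma vle_refl v : vle v v.
Proof. exact: rt_refl. Qed.

Lemma vle_demazure v w c : vI v \subset vI w -> parabolic C (vI w) c ->
  vb v = vb w * c -> bruhat C (va w * c) (va v) -> vle v w.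
Proof.
move=> sI pc eb hb.
have [c1 [pc1 l1 b1 b2]] := demazure_part (vb w) (va_min w) pc.
apply: (@vle_trans (mkv (vb w * c1) (va_min v))); apply: rt_step.
  by left; split; [|apply: bruhat_refl|rewrite eb].
right; split=> //; exists c1; split=> //.
exact: bruhat_trans b2 hb.
Qed.

Lemma zword_split I (w1 : seq Sh) y (w2 : seq Sh) : zword I = w1 ++ y :: w2 ->
  exists s, [/\ s \notin I, y = theta E s & zword (s |: I) = w1 ++ w2].
Proof.
move=> ew.
have [u1 [x [u2 [eu ex eu1 eu2]]]] : exists u1 x u2, [/\ [seq s <- r | s \notin I]
   = u1 ++ x :: u2, y = theta E x, w1 = map (theta E) u1 & w2 = map (theta E) u2].
  move: ew; rewrite /zword; move: [seq _ <- _ | _] => q.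
  elim: w1 q => [|y' w1 IH] [|x q] //= [].
    by move=> <- <-; exists [::], x, q.
  by move=> <- /IH[u1 [x' [u2 [-> -> -> ->]]]]; exists (x :: u1), x', u2.
have uq : uniq (u1 ++ x :: u2) by rewrite -eu filter_uniq.
exists x; split=> //.
  have : x \in u1 ++ x :: u2 by rewrite mem_cat inE eqxx orbT.
  by rewrite -eu mem_filter => /andP[].
rewrite /zword eu1 eu2 -map_cat; congr map.
have -> : [seq s <- r | s \notin x |: I] = [seq s <- u1 ++ x :: u2 | s != x].
  by rewrite -eu -filter_predI; apply: eq_filter => t; rewrite /= !inE negb_or.
move: uq; rewrite filter_cat /= eqxx /= cat_uniq /= negb_or.
case/and4P=> _ /andP[xu1 _] xu2 _.
by congr (_ ++ _); apply/all_filterP/allP => t ht; apply: contraTneq ht => ->.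
Qed.

Lemma zword_del (I : {set S}) s : s \notin I ->
  exists (w1 w2 : seq Sh), zword I = w1 ++ theta E s :: w2 /\ zword (s |: I) = w1 ++ w2.
Proof.
move=> sI; have : theta E s \in zword I by rewrite map_f // mem_filter sI r_enum.
case/splitPr ew: {1}_ / => [w1 w2].
have [t [_ /(@theta_inj _ _ _ _ _ _ E) -> es]] := zword_split ew.
by exists w1, w2.
Qed.

(* An upward edge from [phi v] multiplies on the right by a reflection [t]: for
   [t] in [W] it raises [b]; otherwise it deletes a letter of [z I] or of [a]. *)
Lemma phi_step v t : reflections Ch t -> posA E (phi v) t ->
  exists2 w, phi v * t = phi w & vle v w.
Proof.
move=> rt; rewrite /posA.
have -> : phi v = e (va v) * z (vI v) * (e (vb v))^-1 by [].
have ma := va_min v; have mz := minc_zI ma.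
have pb := par_embV (vb v).
case: asboolP => [pt|npt].
  rewrite addbT (mincoset_invb_par mz pb pt) invgK.
  have /emb_par[t' et] := pt; rewrite et invb_emb => hb.
  have rt' : reflections C t'.
    have := invb_self rt; rewrite et invb_emb; exact: invb_refl.
  exists (mkv (t' * vb v) ma).
    by rewrite phi_mkv emb_mul invgM -(embV E t') (reflV rt') mulgA.
  apply: rt_step; left; split=> //; first exact: bruhat_refl.
  have := @bruhat_step _ _ C (t' * vb v) t'.
  by rewrite invb_mulr // hb mulgA (reflP rt') mul1g; apply.
rewrite addbF (mincoset_invb_npar _ pb npt) => h.
set b := (e (vb v))^-1 in h *; set t1 := b * t * b^-1 in h.
have et : b * t = t1 * b by rewrite /t1 mulgKV.
have -> : e (va v) * z (vI v) * b * t = e (va v) * z (vI v) * t1 * b.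
  by rewrite -mulgA et !mulgA.
have case_split (J : {set S}) (a1 : W) : vI v \subset J -> bruhat C a1 (va v) ->
  e (va v) * z (vI v) * t1 = e a1 * z J ->
  exists2 w, e (va v) * z (vI v) * t1 * b = phi w & vle v w.
  move=> sJ ha1 ->; have [a [c [ha pc ea]]] := coset_decomp C J a1.
  exists (mkv (vb v * c^-1) ha).
    rewrite phi_mkv ea !emb_mul embV invgM invgK !mulgA; congr (_ * _).
    by rewrite -!mulgA (zI_comm pc).
  apply: (@vle_demazure _ _ c) => //; last by rewrite -ea.
  by rewrite /vb /= mulgKV.
move: h; rewrite invgM invbM invgK; case hz : (invb _ (z _)^-1 t1) => /= h.
  move: hz; rewrite invbV; set t2 := z _ * t1 * _ => ht2.
  have et2 : z (vI v) * t1 = t2 * z (vI v) by rewrite /t2 mulgKV.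
  move: ht2; rewrite {1}zIE => /invb_del/refls_split[w1 [y [w2 [/zword_split[s [sI _ es]] e2]]]].
  apply: (@case_split (s |: vI v) (va v)); first exact: finset.subsetUr.
    exact: bruhat_refl.
  by rewrite -!mulgA et2 {1}zIE e2 -es -zIE.
have pinv := par_invb (par_embV (va v)) h.
have /emb_par[p ep] := pinv.
have ez : z (vI v) * t1 = e p * z (vI v) by rewrite -ep mulgKV.
apply: (@case_split (vI v) (va v * p)) => //; last by rewrite -mulgA ez emb_mul !mulgA.
by apply: bruhat_stepr; rewrite -(invb_emb E) embV -ep.
Qed.

Lemma phi_upclosed v y : leA (phi v) y -> exists2 w, y = phi w & vle v w.
Proof.
move=> h; suff H x y' : leA x y' -> forall v, x = phi v -> exists2 w, y' = phi w & vle v w.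
  exact: H h v (erefl _).
move: x y'; apply: leA_ind_step =>
  [x v1 ->|x x1 y' h1 h2 v1 /h1[w /h2[w' -> h3] h4]|x t rt hp v1 ex].
- by exists v1 => //; apply: vle_refl.
- by exists w' => //; apply: vle_trans h3.
by have := phi_step rt (v := v1); rewrite -ex; apply.
Qed.

(* On minimal coset representatives [leA] reverses the Bruhat order ([c = 1]); the
   factor [c] accounts for [vle2].  The induction strips left descents of [x]. *)
Lemma leA_of_bruhat (x y c w : Wh) : minc x -> minc y -> par c -> par w ->
  bruhat Ch (y * c) x -> len Ch w = (len Ch c + len Ch (c * w))%N ->
  leA (x * w) (y * c * w).
Proof.
move: {2}(len Ch x) (erefl (len Ch x)) => n; elim: n x y c => [|n IH] x y c hn hx hy hc hw.
  move=> /bruhat_len_eq; rewrite hn => h _; have := h (leq0n _) => {}h.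
  by rewrite h; apply: ro_refl.
move=> hb hl.
have [s hs] := desc_ex hn.
have hsx : minc (gen Ch s * x) by apply: mincoset_desc hx _; rewrite hs hn.
have lsx : (lA (x * w) < lA (gen Ch s * x * w)%g)%R.
  by rewrite (twlen_A hx hw) (twlen_A hsx hw) hs hn; lia.
have lsx' : (lA (gen Ch s * (gen Ch s * x * w)) < lA (gen Ch s * x * w)%g)%R.
  by rewrite -(mulgA (gen Ch s)) genK mulgA.
have ssx : x * w = gen Ch s * (gen Ch s * x * w) by rewrite -(mulgA (gen Ch s)) genK.
have hcw : par (c * w) by apply: parM.
have up : len Ch (y * c) < len Ch (gen Ch s * (y * c)) -> leA (x * w) (y * c * w).
  move=> h; have [|h1 _] := bruhat_lift hb h; first by rewrite hs hn.
  apply: leA_trans (IH _ _ _ hs hsx hy hc hw h1 hl).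
  by rewrite -(mulgA (gen Ch s)); apply: leA_gen; rewrite mulgA.
have down y' c' : minc y' -> par c' -> gen Ch s * (y * c) = y' * c' ->
  len Ch (y' * c') < len Ch (y * c) ->
  len Ch w = (len Ch c' + len Ch (c' * w))%N ->
  (lA (y * c * w) < lA (y' * c' * w)%g)%R -> leA (x * w) (y * c * w).
  move=> hy' hc' eyc h hl' lA1; have h1 := bruhat_dd (s := s) hb.
  rewrite eyc hs hn in h1.
  have {}h1 := IH _ _ _ hs hsx hy' hc' hw (h1 h (leqnn _)) hl'.
  have ey : y * c * w = gen Ch s * (y' * c' * w) by rewrite -eyc -(mulgA (gen Ch s)) genK.
  by rewrite ssx ey; apply: leA_dd h1 lsx' _; rewrite -ey.
have e1 : gen Ch s * (y * c) = gen Ch s * y * c by rewrite mulgA.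
have lyc := mincoset_add hy hc.
have lAy : lA (y * c * w) = ((len Ch (c * w))%:Z - (len Ch y)%:Z)%R.
  have -> : y * c * w = y * (c * w) by rewrite mulgA.
  by rewrite twlen_A.
case: (mincoset_left s hy) => [hsy|[q qJ ey]].
  have lsyc := mincoset_add hsy hc.
  have := len_genl Ch s y; case: ifP => _ lsy.
    apply: (@down (gen Ch s * y) c) => //; first by rewrite lsyc lyc; lia.
    have -> : gen Ch s * y * c * w = gen Ch s * y * (c * w) by rewrite !mulgA.
    by rewrite lAy twlen_A //; lia.
  by apply: up; rewrite e1 lsyc lyc; lia.
have pq : par (gen Ch q) by apply: par_gen.
have pqc : par (gen Ch q * c) by apply: parM.
have e2 : gen Ch s * (y * c) = y * (gen Ch q * c) by rewrite e1 ey -mulgA.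
have lyqc := mincoset_add hy pqc.
have := len_genl Ch q c; case: ifP => _ lqc; last by apply: up; rewrite e2 lyqc lyc; lia.
have lqcw : len Ch (gen Ch q * c * w) = (len Ch (c * w)).+1.
  have := len_genl Ch q (c * w).
  have -> : gen Ch q * (c * w) = gen Ch q * c * w by rewrite mulgA.
  have := lenM Ch (gen Ch q * c)^-1 (gen Ch q * c * w); rewrite mulKg lenV.
  by case: ifP; lia.
apply: (@down y (gen Ch q * c)) => //; try lia.
have -> : y * (gen Ch q * c) * w = y * (gen Ch q * c * w) by rewrite !mulgA.
by rewrite lAy twlen_A //; [lia | apply: parM].
Qed.

Lemma bruhat_mulK p q x : bruhat C p q -> parabolic Ch hatK x ->
  bruhat Ch (e p * x) (e q * x).
Proof.
move=> h px; move: p q h.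
apply: bruhat_ind_step => [p|p q u|p t h]; [exact: bruhat_refl|exact: bruhat_trans|].
rewrite emb_mul -mulgA; apply: bruhat_step; rewrite invbM invb_emb h.
by rewrite -embV -!emb_mul invb_K_par //; apply: par_emb.
Qed.

Lemma bruhat_zI p (I J : {set S}) : I \subset J -> bruhat Ch (e p * z J) (e p * z I).
Proof.
move: {2}(#|J :\: I|) (leqnn #|J :\: I|) => n; elim: n I => [|n IH] I hn sIJ.
  have -> : I = J.
    apply/eqP; rewrite finset.eqEsubset sIJ -finset.setD_eq0 -cards_eq0.
    by case: #|_| hn.
  exact: bruhat_refl.
case: (set_0Vmem (J :\: I)) => [h|[s sJI]].
  by apply: IH => //; rewrite h cards0.
move: (sJI); rewrite inE => /andP[sI sJ].
apply: (@bruhat_trans _ _ _ (e p * z (s |: I))).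
  apply: IH; last by rewrite finset.subUset finset.sub1set sJ.
  have -> : J :\: (s |: I) = (J :\: I) :\ s.
    by apply/setP => t; rewrite !inE negb_or andbA [(t != s) && _]andbC.
  by move: hn; rewrite (cardsD1 s (J :\: I)) sJI.
have [w1 [w2 [e1 e2]]] := zword_del sI.
pose p1 := e p * wprod Ch w1.
have -> : e p * z (s |: I) = (p1 * th s * p1^-1) * (e p * z I).
  rewrite !zIE e1 e2 !wprod_cat wprod_cons /p1 invgM !mulgA mulgKV.
  by rewrite -!mulgA mulKg genK.
apply: bruhat_step; rewrite -ltn_lenr; last exact/reflJ/refl_gen.
have -> : (p1 * th s * p1^-1) * (e p * z I) = e p * z (s |: I).
  rewrite !zIE e1 e2 !wprod_cat wprod_cons /p1 invgM !mulgA mulgKV.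
  by rewrite -!mulgA mulKg genK.
rewrite !len_aI cardsU1 sI; have : #|s |: I| <= #|S| by apply: max_card.
by rewrite cardsU1 sI; lia.
Qed.

Lemma phi_vle1 v w : vle1 v w -> leA (phi v) (phi w).
Proof.
move=> [sI ha hb].
apply: (@leA_trans _ _ _ _ _ _ E (e (va w) * z (vI w) * (e (vb v))^-1)).
  rewrite -[e (va w) * z (vI w)]mulg1; apply: leA_of_bruhat.
  - exact: minc_zI (va_min v).
  - exact: minc_zI (va_min w).
  - exact: par1.
  - exact: par_embV.
  - rewrite mulg1; apply: bruhat_trans (bruhat_zI _ sI).
    by apply: bruhat_mulK => //; apply: parK_zI.
  - by rewrite mul1g len1.
rewrite /Defs.phi; move: (vb v) (vb w) hb.
apply: bruhat_ind_step => [x|x y y'|x t ht]; [exact: ro_refl|exact: ro_trans|].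
have m := minc_zI (va_min w).
have rt : reflections Ch (e t) by apply: (@invb_refl _ _ Ch (e x)); rewrite invb_emb.
set y := e (va w) * _ in m *.
have ey : y * (e x)^-1 = y * (e (t * x))^-1 * e t by rewrite emb_mul invgM -!mulgA mulVg mulg1.
rewrite ey; apply: leA_stepr => //; rewrite -lA_lt // -ey.
by rewrite !(twlen_A m (par_embV _)) !lenV !len_emb; have := invb_len ht; lia.
Qed.

Lemma phi_vle2 v w : vle2 v w -> leA (phi v) (phi w).
Proof.
move=> [sI [c [pc eb hl hb]]].
have -> : phi w = e (va w) * z (vI w) * e c * (e (vb v))^-1.
  by rewrite /Defs.phi eb emb_mul invgM !mulgA mulgK.
apply: leA_of_bruhat.
- exact: minc_zI (va_min v).
- exact: minc_zI (va_min w).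
- exact: par_emb.
- exact: par_embV.
- rewrite -mulgA (zI_comm pc) mulgA -emb_mul; apply: bruhat_trans (bruhat_zI _ sI).
  by apply: bruhat_mulK => //; apply: parK_zI.
have -> : e c * (e (vb v))^-1 = (e (vb w))^-1 by rewrite eb emb_mul invgM !mulgA mulgV mul1g.
by rewrite !lenV !len_emb hl addnC.
Qed.

Lemma phi_leA v w : leA (phi v) (phi w) <-> vle v w.
Proof.
split=> [/phi_upclosed[w' /phi_inj -> //]|].
elim=> {v w} [v w [/phi_vle1|/phi_vle2]|v|v w x _ h _]//; first exact: ro_refl.
exact: ro_trans.
Qed.

Lemma vle_len_va v w : vle v w -> len C (va w) <= len C (va v).
Proof.
elim=> {v w} [v w [[_ /bruhat_len//]|[_ [c [pc _ _ /bruhat_len h]]]]|//|v w x _ h _ h'].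
  by move: h; rewrite (mincoset_add (va_min w) pc); apply/leq_trans/leq_addr.
exact: leq_trans h' h.
Qed.

Lemma vle_vI v w : vle v w -> vI v \subset vI w.
Proof.
elim=> {v w} [v w [[]//|[]//]|//|v w x _ h _ h'].
exact: fintype.subset_trans h h'.
Qed.

Lemma vle_a1 v w : vle v w -> va v = 1 -> va w = 1 /\ bruhat C (vb v) (vb w).
Proof.
elim=> {v w} [v w [[_ h1 h2] ev|[_ [c [pc eb hl h1]]] ev]|v|v w x _ h _ h' /h[/h'[ex b1] b2]].
- split=> //; rewrite ev in h1; apply: bruhat_len_eq h1 _.
  by rewrite len1.
- move: h1; rewrite ev => /bruhat_len; rewrite len1 (mincoset_add (va_min w) pc) leqn0 addn_eq0.
  rewrite !len_eq0 => /andP[/eqP -> /eqP ec]; split=> //.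
  by rewrite eb ec mulg1; apply: bruhat_refl.
- by move=> ->; split=> //; apply: bruhat_refl.
by split=> //; apply: bruhat_trans b2 b1.
Qed.

Local Open Scope ring_scope.
Local Notation fullS := [set: S]%SET.
Implicit Types (x y : Wh).

Lemma vactK (o : S + S) : involutive (@vact _ _ C o).
Proof.
case: o => s v.
  by apply: (phi_inj); rewrite !phi_inl genK.
by apply: vext => //=; rewrite /vb /= genK.
Qed.

Lemma vdim_lt v w : (vdim v < vdim w) = (lA (phi v) < lA (phi w)).
Proof. by rewrite !(lA_phi) ltrD2r. Qed.

Lemma vdim_inr s v : (vdim v < vdim (vact (inr s) v)) = (len C (vb v) < len C (gen C s * vb v)%g)%N.
Proof.
rewrite /vdim -[vI (vact _ _)]/(vI v) -[va (vact _ _)]/(va v).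
by rewrite -[vb (vact _ _)]/(gen C s * vb v)%g; apply/idP/idP; lia.
Qed.

Lemma vdim_vact (o : S + S) v : vdim (vact o v) <> vdim v.
Proof.
case: o => s.
  move=> h; have := @lA_gen _ _ _ _ _ _ E (inc E s) (phi v).
  by rewrite -phi_inl // !(lA_phi) h.
rewrite /vdim -[vI (vact _ _)]/(vI v) -[va (vact _ _)]/(va v) -[vb (vact _ _)]/(_ * vb v)%g.
by have := @len_genl_neq _ _ C s (vb v); lia.
Qed.

Lemma vact_neq (o : S + S) v : vact o v != v.
Proof. by apply/eqP => h; apply: (@vdim_vact o v); rewrite h. Qed.

Lemma fsum_pair (T : choiceType) (F : T -> laurent) a b : a != b ->
  (forall i, i != a -> i != b -> F i = 0) -> \sum_(i \in [set: T]) F i = F a + F b.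
Proof.
move=> ab h; rewrite (fsbigE [:: a; b]) //=; last first.
- by move=> i _; rewrite !inE negb_or => /andP[]; apply: h.
- by rewrite inE ab.
by rewrite !big_cons big_nil !in_setT addr0.
Qed.

Lemma fsum_single (T : choiceType) (F : T -> laurent) a :
  (forall i, i != a -> F i = 0) -> \sum_(i \in [set: T]) F i = F a.
Proof.
move=> h; rewrite (fsbigE [:: a]) //=; last first.
  by move=> i _; rewrite inE; apply: h.
by rewrite big_cons big_nil in_setT addr0.
Qed.

Definition delta v : V -> laurent := fun w => (w == v)%:R.

Lemma delta_in_M v : in_M (delta v).
Proof.
apply: (sub_finite_set (B := [set v])); last exact: finite_set1.
by move=> w /=; rewrite /delta; case: (eqVneq w v) => // _; rewrite eqxx.
Qed.

Lemma heckeT_delta (o : S + S) v : heckeT o (delta v) = heckeTm o v.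
Proof.
apply/funext => w; rewrite /heckeT (fsum_single (a := v)); first by rewrite /delta eqxx mul1r.
by move=> i /negPf h; rewrite /delta h mul0r.
Qed.

Lemma semilin_delta b v : semilin b (delta v) = b^~ v.
Proof.
apply/funext => w; rewrite /semilin (fsum_single (a := v)).
  by rewrite /delta eqxx bar1 mul1r.
by move=> i /negPf h; rewrite /delta h bar0 mul0r.
Qed.

Lemma semilin_heckeTm b (o : S + S) v w : semilin b (heckeTm o v) w =
  b w (vact o v) + (if vdim (vact o v) < vdim v then bar alpha * b w v else 0).
Proof.
have ne := vact_neq o v.
rewrite /semilin (fsum_pair (a := vact o v) (b := v)) //.
  rewrite /heckeTm eqxx (negPf ne) [v == _]eq_sym (negPf ne) eqxx mulr0 mulr1.
  rewrite if_same addr0 bar1 mul1r add0r; congr (_ + _).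
  by case: ifP; rewrite ?bar0 ?mul0r.
by move=> i /negPf h1 /negPf h2; rewrite /heckeTm h1 h2 mulr0 if_same addr0 bar0 mul0r.
Qed.

Lemma heckeTE (o : S + S) f w : heckeT o f w =
  f (vact o w) + (if vdim (vact o w) < vdim w then alpha * f w else 0).
Proof.
have ne := vact_neq o w.
rewrite /heckeT (fsum_pair (a := vact o w) (b := w)) //.
  rewrite /heckeTm vactK eqxx [w == vact o w]eq_sym (negPf ne) mulr0 if_same addr0 mulr1.
  by rewrite add0r mulr1; congr (_ + _); case: ifP => _; rewrite ?mulr0 // mulrC.
move=> i h1 h2; rewrite /heckeTm [w == i]eq_sym (negPf h2) mulr0 if_same addr0.
case: eqP => [e1|_]; last by rewrite mulr0.
by case/eqP: h1; rewrite e1 vactK.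
Qed.

Section BTilde.
Variable b : V -> V -> laurent.
Hypothesis hb : is_btilde b.

Lemma b_row (o : S + S) v w : vdim w < vdim (vact o w) ->
  b w v = b (vact o w) (vact o v)
          + (if vdim (vact o v) < vdim v then bar alpha * b (vact o w) v else 0).
Proof.
move=> h; have [R [_ hT _]] := hb.
have := hT o _ (delta_in_M v) (vact o w).
rewrite heckeT_delta semilin_heckeTm /heckeTinv heckeTE semilin_delta vactK h => ->.
by rewrite addrK.
Qed.

Lemma b_col (o : S + S) v w : vdim v < vdim (vact o v) ->
  b w (vact o v) = b (vact o w) v
                   + (if vdim w < vdim (vact o w) then bar alpha * b w v else 0).
Proof.
move=> h; have [R [_ hT _]] := hb.
have := hT o _ (delta_in_M v) w.
rewrite heckeT_delta semilin_heckeTm /heckeTinv heckeTE semilin_delta ifF ?addr0; last by lia.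
move=> ->; rewrite -addrA; congr (_ + _); have := @vdim_vact o w.
case: ltP => h1; case: ltP => h2; rewrite ?subrr ?sub0r ?bar_alpha ?mulNr //; lia.
Qed.

Lemma b_at1 v w : vb v = 1%g -> va w = 1%g ->
  b w v = if (vI w \subset vI v) && (va v == 1%g) && (vb w == 1%g)
          then bar alpha ^+ (#|vI v| - #|vI w|) else 0.
Proof.
move=> hv hw; have [R [[R1 R0 _] _ ->//]] := hb; rewrite hw.
have Rt (x : W) : Rtilde C R x 1%g = (x == 1%g)%:R.
  rewrite /Rtilde; case: eqP => [->|ne].
    by rewrite R1 len1 psubst1 mulr1 oppr0 addr0 expr0z.
  rewrite R0 ?psubst0 ?mulr0 // => /bruhat_len_eq h; apply: ne; apply: h.
  by rewrite len1.
rewrite Rt -andbA; case: (vI w \subset vI v) => //=.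
case: asboolP => [pb|npb].
  have -> : (va v * vb w == 1)%g = (va v == 1%g) && (vb w == 1%g).
    by rewrite -!(len_eq0 C) (mincoset_add (va_min v) pb) addn_eq0.
  by case: (_ && _); rewrite ?mulr1 ?mulr0.
case: (vb w =P 1%g) => [e1|_]; last by rewrite andbF.
by case: npb; rewrite e1; apply: par1.
Qed.

End BTilde.

(* The recursion is along rows, while [is_twR] is along columns: in this form it is
   shared by [R^A] and the transpose of the family attached to the complement of [A]. *)
Definition vone (I : {set S}) (b : W) : V := mkv b (@mincoset1 _ _ C I).

Lemma vdim_vone I b : vdim (vone I b) = (len C b)%:Z + #|I|%:Z.
Proof. by rewrite /vdim -[va _]/(1%g : W) len1 oppr0 add0r. Qed.

Section BQ.
Variable b : V -> V -> laurent.
Hypothesis hb : is_btilde b.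

Lemma b_a1 w v : va w = 1%g -> b w v =
  if (vI w \subset vI v) && (va v == 1%g)
  then bar alpha ^+ (#|vI v| - #|vI w|) * b (vone fullS (vb w)) (vone fullS (vb v)) else 0.
Proof.
move: {2}(len C (vb v)) (erefl (len C (vb v))) => n; elim: n w v => [|n IH] w v hn hw.
  have hv : vb v = 1%g by apply/eqP; rewrite -(len_eq0 C) hn.
  rewrite (b_at1 hb hv hw) (b_at1 hb (v := vone _ _)) // hv.
  rewrite -[vI (vone _ _)]/fullS -[va (vone _ _)]/(1%g : W) -[vb (vone _ _)]/(vb w).
  by rewrite fintype.subxx eqxx subnn; case: (vb w == _);
    rewrite ?andbT ?andbF ?mulr1 ?mulr0 // if_same.
have [s hs] := desc_ex hn.
pose v0 := vact (inr s) v.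
have ev : v = vact (inr s) v0 by rewrite vactK.
have hv0 : vb v0 = (gen C s * vb v)%g by [].
have lt0 : vdim v0 < vdim (vact (inr s) v0).
  by rewrite vdim_inr hv0 genK hs hn.
have eT : vone fullS (vb v) = vact (inr s) (vone fullS (vb v0)).
  by apply: vext => //; rewrite {1}ev.
have ltT : vdim (vone fullS (vb v0)) < vdim (vact (inr s) (vone fullS (vb v0))).
  by rewrite vdim_inr -[vb (vone _ _)]/(vb v0) hv0 genK hs hn.
have eTw : vact (inr s) (vone fullS (vb w)) = vone fullS (vb (vact (inr s) w)) by apply: vext.
rewrite {1}ev (b_col hb _ lt0) eT (b_col hb _ ltT) !vdim_inr eTw.
rewrite (IH (vact (inr s) w) v0) ?hv0 // (IH w v0) ?hv0 //.
rewrite -[vI (vact _ _)]/(vI w) -[vI v0]/(vI v) -[va v0]/(va v) -[vb (vone _ (vb w))]/(vb w).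
case: ifP => _; last by rewrite mulr0 if_same addr0.
by rewrite mulrDr; congr (_ + _); case: ifP; rewrite ?mulr0 // mulrCA.
Qed.

End BQ.

Section QonV.
Variable Q : Wh -> Wh -> laurent.
Hypothesis hQ : is_Qrec E Q.

Lemma Q_vle w v : ~ vle w v -> Q (phi w) (phi v) = 0.
Proof. by move=> h; have [_ Q0 _] := hQ; apply: Q0 => /(phi_leA). Qed.

Lemma zword_head (I : {set S}) : I != fullS -> exists2 t, t \notin I &
  forall J : {set S}, I \subset J -> t \notin J -> zword J = theta E t :: zword (t |: J).
Proof.
move=> nI; have h : has (fun s => s \notin I) r.
  apply/hasP; have [s sI] : exists s, s \notin I.
    apply/existsP; apply: contra_neqT nI; rewrite negb_exists => /forallP h.
    by apply/setP => s; rewrite inE; apply/negPn.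
  by exists s.
have [p [t [q [er tI hp]]]] : exists p t q,
    [/\ r = p ++ t :: q, t \notin I & all (mem I) p].
  elim: (r) h => //= s q IH; case: (boolP (s \in I)) => [sI /= /IH|sI _].
    by move=> [p [t [q' [-> tI hp]]]]; exists (s :: p), t, q'; split; rewrite //= sI.
  by exists [::], s, q.
exists t => // J /fintype.subsetP IJ tJ.
have tq : t \notin q by move: r_uniq; rewrite er cat_uniq /= => /and4P[].
have pJ (K : {set S}) : J \subset K -> [seq s <- p | s \notin K] = [::].
  move=> /fintype.subsetP JK; apply/eqP; rewrite -[_ == _]negbK -has_filter.
  by apply/hasPn => s /(allP hp)/IJ/JK; rewrite negbK.
rewrite /zword er !filter_cat !pJ ?finset.subsetUr //= tJ in_setU1 eqxx /=.
congr (_ :: map _ _); apply: eq_in_filter => s sq; rewrite in_setU1 negb_or.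
by rewrite (_ : s != t) //; apply: contraNneq tq => <-.
Qed.

Lemma Q_a1 w v : va w = 1%g -> Q (phi w) (phi v) =
  if (vI w \subset vI v) && (va v == 1%g)
  then bar alpha ^+ (#|vI v| - #|vI w|)
       * Q (phi (vone fullS (vb w))) (phi (vone fullS (vb v))) else 0.
Proof.
move=> hw; case: (boolP (vI w \subset vI v)) => [sI|nI]; last first.
  by rewrite Q_vle // => /vle_vI; apply/negP.
case: (va v =P 1%g) => [hv|nv]; last first.
  by rewrite Q_vle // => /vle_a1/(_ hw)[].
rewrite /=; move: {2}(#|S| - #|vI w|)%N (erefl (#|S| - #|vI w|)%N) => n.
elim: n w v hw sI hv => [|n IH] w v hw sI hv hn.
  have wT : vI w = fullS.
    by apply/eqP; rewrite eqEcard finset.subsetT cardsT; move/eqP: hn.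
  have vT : vI v = fullS by apply/eqP; rewrite -finset.subTset -wT.
  by rewrite wT vT subnn mul1r; congr (Q (phi _) (phi _)); apply: vext.
have wT : vI w != fullS.
  by apply/eqP => h; move: hn; rewrite h cardsT subnn.
have [t tI ht] := zword_head wT.
have ez (J : {set S}) : vI w \subset J -> t \notin J -> z J = (th t * z (t |: J))%g.
  by move=> sJ tJ; rewrite !zIE (ht J) // wprod_cons.
pose w1 := vone (t |: vI w) (vb w).
have ephi (w2 : V) : va w2 = 1%g -> phi w2 = (z (vI w2) * (e (vb w2))^-1)%g.
  by move=> hx; rewrite /Defs.phi hx emb1 mul1g.
have ew1 : (th t * phi w)%g = phi w1.
  by rewrite !ephi // ez // !mulgA gen_sq mul1g.
have cw1 : #|t |: vI w| = #|vI w|.+1 by rewrite cardsU1 tI.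
have ltw : vdim w < vdim w1.
  rewrite /vdim hw -[vI w1]/(t |: vI w) -[va w1]/(1%g : W) -[vb w1]/(vb w) cw1.
  by lia.
have hn1 : (#|S| - #|vI w1|)%N = n by rewrite cw1; lia.
have [_ _ Qr] := hQ; rewrite (Qr (theta E t)) ew1 -?vdim_lt //.
have lw : (#|vI w|.+1 <= #|S|)%N by rewrite -cw1; apply: max_card.
case: (boolP (t \in vI v)) => tJ.
  have hJ : (theta E t) \notin zword (vI v).
    rewrite /zword mem_map; last exact: theta_inj.
    by rewrite mem_filter tJ.
  have uJ : uniq (theta E t :: zword (vI v)) by rewrite /= hJ zword_uniq.
  have eth : (th t * phi v)%g = (wprod Ch (theta E t :: zword (vI v)) * (e (vb v))^-1)%g.
    by rewrite ephi // wprod_cons mulgA zIE.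
  have pK : parabolic Ch (hatK) (wprod Ch (theta E t :: zword (vI v))).
    rewrite wprod_cons -zIE; apply: parM; last exact: parK_zI.
    by apply: par_gen; apply/imsetP; exists t.
  have hlt : lA (th t * phi v)%g < lA (phi v).
    rewrite eth (twlen_A (minc_K pK) (par_embV _)) len_uniq //=.
    rewrite ephi // (twlen_A (minc_K (parK_zI _)) (par_embV _)).
    by rewrite zIE len_uniq ?zword_uniq //; lia.
  rewrite hlt; have [_ Q0 _] := hQ; rewrite Q0 ?add0r; last first.
    move=> /(phi_upclosed)[w' ew' lw'].
    have [aw' _] := vle_a1 lw' erefl.
    have tw' : t \in vI w' by apply: (fintype.subsetP (vle_vI lw')); rewrite !inE eqxx.
    move: ew'; rewrite eth ephi // => ew'.
    have [ezz _] := mincoset_uniq (minc_K pK) (minc_K (parK_zI _))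
                     (par_embV _) (par_embV _) ew'.
    have pw : parabolic Ch [set s in zword (vI w')] (wprod Ch (theta E t :: zword (vI v))).
      rewrite ezz zIE; exists (zword (vI w')) => //.
      by apply/allP => s; rewrite /= inE.
    have /andP[] := par_letters (len_uniq Ch uJ) pw.
    rewrite /= inE mem_map; last exact: theta_inj.
    by rewrite mem_filter tw'.
  rewrite (IH w1 v) //; last by rewrite finset.subUset finset.sub1set tJ.
  rewrite -[vI w1]/(t |: vI w) -[vb w1]/(vb w) cw1 mulrA -exprS; congr (_ ^+ _ * _).
  by have := subset_leq_card sI; have : (t |: vI w) \subset vI v;
   [rewrite finset.subUset finset.sub1set tJ | move/subset_leq_card; rewrite cw1; lia].
pose v1 := vone (t |: vI v) (vb v).
have ev1 : (th t * phi v)%g = phi v1 by rewrite !ephi // ez // !mulgA gen_sq mul1g.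
have cv1 : #|t |: vI v| = #|vI v|.+1 by rewrite cardsU1 tJ.
have ltv : vdim v < vdim v1.
  rewrite /vdim hv -[vI v1]/(t |: vI v) -[va v1]/(1%g : W) -[vb v1]/(vb v) cv1.
  by lia.
rewrite ev1 ifF ?addr0; last by move: ltv; rewrite vdim_lt; lia.
rewrite (IH w1 v1) //; last by rewrite finset.setUS.
by rewrite -[vI w1]/(t |: vI w) -[vI v1]/(t |: vI v) cw1 cv1 subSS.
Qed.

Lemma Q_b (b : V -> V -> laurent) w v : is_btilde b -> Q (phi w) (phi v) = b w v.
Proof.
move=> hb; have [Q1 Q0 Qr] := hQ.
have QT b1 b2 : Q (phi (vone fullS b1)) (phi (vone fullS b2)) = b (vone fullS b1) (vone fullS b2).
  move: {2}(len C b2) (erefl (len C b2)) => n; elim: n b1 b2 => [|n IH] b1 b2 hn.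
    have hv : b2 = 1%g by apply/eqP; rewrite -(len_eq0 C) hn.
    rewrite (b_at1 hb) // -[vI (vone _ _)]/fullS -[va (vone _ _)]/(1%g : W) -[vb (vone _ _)]/b1.
    rewrite fintype.subxx eqxx subnn hv /=.
    have phi1 : phi (vone fullS 1%g) = 1%g.
      rewrite /Defs.phi /zI big1 => [|s]; last by rewrite inE.
      by rewrite -[va _]/(1%g : W) -[vb _]/(1%g : W) emb1 invg1 !mulg1.
    case: eqP => [->|nb]; first by rewrite phi1 Q1.
    rewrite Q_vle // => /vle_a1/(_ erefl)[_ /bruhat_len_eq h]; apply: nb; apply: h.
    by rewrite len1.
  have [s hs] : exists s, len C (gen C s * b2^-1)%g = n by apply: desc_ex; rewrite lenV.
  have vT c : vact (inl s) (vone fullS c) = vone fullS (c * gen C s)%g.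
    case: (vact_inl s (vone fullS c)) => [[eI ea _]|[t [_ + eI ea eb]]].
      have := va_min (vact (inl s) (vone fullS c)); rewrite eI ea.
      rewrite -[va (vone _ _)]/(1%g : W) -[vI (vone _ _)]/fullS mulg1 => /mincoset_gen.
      by move=> /(_ s (finset.in_setT s)); rewrite gen_sq len1.
    rewrite -[va (vone _ _)]/(1%g : W) mulg1 mul1g => est.
    by apply: vext; rewrite ?eI ?ea ?eb ?est.
  set b3 := (b2 * gen C s)%g.
  have l3 : len C b3 = n by rewrite -hs -lenV /b3 invgM genV.
  have e3 : vone fullS b2 = vact (inl s) (vone fullS b3) by rewrite vT /b3 mulg_genK.
  have lt3 : vdim (vone fullS b3) < vdim (vact (inl s) (vone fullS b3)).
    by rewrite -e3 !vdim_vone l3 hn; lia.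
  rewrite e3 (b_col hb _ lt3) phi_inl (Qrec_col _ hQ) -?phi_inl -?vdim_lt //.
  by rewrite !vT !IH.
move: {2}(len C (va w)) (erefl (len C (va w))) => n; elim: n w v => [|n IH] w v hn.
  have hw : va w = 1%g by apply/eqP; rewrite -(len_eq0 C) hn.
  by rewrite Q_a1 // (b_a1 hb) // QT.
have [s hs] := desc_ex hn.
pose w1 := vact (inl s) w.
have [eI ea eb] : [/\ vI w1 = vI w, va w1 = (gen C s * va w)%g & vb w1 = vb w].
  case: (vact_inl s w) => // -[t [tI et _ _ _]].
  by move: hs; rewrite et (mincoset_gen (va_min w) tI) hn; lia.
have lt1 : vdim w < vdim (vact (inl s) w).
  by rewrite -/w1 /vdim eI ea eb hs hn; lia.
rewrite (b_row hb _ lt1) (Qr (inc E s)) -?phi_inl -?vdim_lt // -/w1.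
by rewrite !(IH w1) // ea hs.
Qed.

End QonV.

Implicit Types f g : V -> V -> laurent.

Definition ball n : seq W :=
  flatten [seq [seq wprod C (tval t) | t <- enum {: k.-tuple S}] | k <- iota 0 n.+1].

Lemma mem_ball n (x : W) : (len C x <= n)%N -> x \in ball n.
Proof.
move=> h; apply/flattenP; exists [seq wprod C (tval t) | t <- enum {: (len C x).-tuple S}].
  by apply/mapP; exists (len C x) => //; rewrite mem_iota add0n ltnS.
have hs : size (rword C x) == len C x by rewrite size_rword.
by apply/mapP; exists (Tuple hs); rewrite ?mem_enum //= rwordE.
Qed.

Lemma vle_vdim w v : vle w v -> vdim w <= vdim v.
Proof.
move=> /(phi_leA)/ro_le; rewrite !(lA_phi).
by rewrite lerD2r.
Qed.

Lemma vle_vdim_lt w v : vle w v -> w <> v -> vdim w < vdim v.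
Proof.
move=> /(phi_leA)/ro_eq_lt; rewrite !(lA_phi).
by rewrite ltrD2r => -[/(phi_inj)|].
Qed.

Lemma vinterval_seq w v : exists s : seq V, uniq s /\ forall z, z \in s <-> vinterval w v z.
Proof.
pose N := (len C (va w) + len C (vb v) + #|S|)%N.
pose T := pmap (insub : _ -> option V)
   [seq (p, b) | p <- [seq (K, a) | K <- enum {: {set S}}, a <- ball N], b <- ball N].
have hT z : vinterval w v z -> z \in T.
  move=> [h1 h2]; have := vle_len_va h1; have := vle_vdim h2; rewrite /vdim => h3 h4.
  rewrite mem_pmap_sub; have : (#|vI v| <= #|S|)%N by apply: max_card.
  move=> h5; apply/allpairsP; exists (vI z, va z, vb z); split=> //=.
  - apply/allpairsP; exists (vI z, va z); split=> //=; first by rewrite mem_enum.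
    by apply: mem_ball; rewrite /N; lia.
  - by apply: mem_ball; rewrite /N; lia.
  by rewrite /vI /va /vb -[sval z]/(val z); case: (val z) => [[]].
exists (undup [seq z <- T | `[< vinterval w v z >]]); split; first exact: undup_uniq.
move=> z; rewrite mem_undup mem_filter; split=> [/andP[/asboolP //]|h].
by rewrite hT // andbT; apply/asboolP.
Qed.

Definition vint w v : seq V := projT1 (cid (vinterval_seq w v)).

Lemma vint_uniq w v : uniq (vint w v).
Proof. by rewrite /vint; case: cid => s []. Qed.

Lemma mem_vint w v z : z \in vint w v <-> vle w z /\ vle z v.
Proof. by rewrite /vint; case: cid => s []. Qed.

Lemma vint_l w v : vle w v -> w \in vint w v.
Proof. by move=> h; apply/mem_vint; split=> //; apply: vle_refl. Qed.

Lemma sum_vinterval (T : nmodType) (F : V -> T) w v :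
  \sum_(z \in vinterval w v) F z = \sum_(z <- vint w v) F z.
Proof.
rewrite (fsbigE (vint w v)) ?vint_uniq //; first last.
- by move=> z /mem_vint ->.
- by move=> z /mem_vint.
rewrite big_seq_cond [RHS]big_seq; apply: eq_bigl => z.
by case: (boolP (z \in vint w v)) => //= /mem_vint h; apply/mem_set.
Qed.

Lemma sum_phi_vint (T : nmodType) (G : Wh -> T) (D : set Wh) w v :
  (forall x, D x <-> leA (phi w) x /\ leA x (phi v)) ->
  \sum_(x \in D) G x = \sum_(z <- vint w v) G (phi z).
Proof.
move=> hD.
have hD' x : D x <-> x \in map phi (vint w v).
  rewrite hD; split=> [[h1 h2]|/mapP[z /mem_vint[h1 h2] ->]]; last first.
    by split; apply/(phi_leA).
  have [z ez h] := phi_upclosed h1.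
  apply/mapP; exists z => //; apply/mem_vint; split=> //.
  by apply/(phi_leA); rewrite -ez.
rewrite (fsbigE (map phi (vint w v))); first last.
- by move=> x /hD' ->.
- by move=> x /hD'.
- by rewrite map_inj_uniq ?vint_uniq //; apply: phi_inj.
rewrite big_seq_cond [X in X = _](eq_bigl (fun x => x \in map phi (vint w v))).
  by rewrite -big_seq big_map.
by move=> x; case: (boolP (x \in map _ _)) => //= /hD' h; apply/mem_set.
Qed.

Section Unique.
Variable b : V -> V -> laurent.

Definition is_KL f : Prop :=
  [/\ forall v, f v v = 1, forall w v, vle w v -> w <> v -> in_neg (f w v)
    & forall w v, vle w v -> f w v = \sum_(z <- vint w v) b w z * bar (f z v)].

Lemma KL_b1 f v : is_KL f -> b v v = 1.
Proof.
move=> [f1 _ /(_ v v (vle_refl v))]; rewrite f1.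
rewrite (bigD1_seq v) ?vint_uniq ?vint_l //=; last exact: vle_refl.
rewrite f1 bar1 mulr1 big_seq_cond big1 ?addr0 // => z /andP[/mem_vint[h1 h2] /eqP nz].
by have := vle_vdim_lt h1 (fun e => nz (esym e)); have := vle_vdim h2; lia.
Qed.

Lemma KL_unique f g w v : is_KL f -> is_KL g -> vle w v -> f w v = g w v.
Proof.
move=> hf hg; have b1 u := KL_b1 u hf.
move: {2}(`|vdim v - vdim w|)%N (leqnn `|vdim v - vdim w|%N) => n.
elim: n w => [|n IH] w hn h; case: (pselect (w = v)) => [->|nwv];
  try by case: hf => -> _ _; case: hg => ->.
  by have := vle_vdim_lt h nwv; lia.
have [f1 fn fs] := hf; have [g1 gn gs] := hg.
apply/eqP; rewrite -subr_eq0; apply/eqP; apply: in_neg_bar_eq0.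
  by apply: in_negD; [apply: fn | apply/in_negN/gn].
rewrite [in RHS](fs w v h) [in RHS](gs w v h) -sumrB.
rewrite (bigD1_seq w) ?vint_uniq ?vint_l //= b1 !mul1r barD barN big_seq_cond big1 ?addr0 //.
move=> z /andP[/mem_vint[h1 h2] /eqP nz].
have := vle_vdim_lt h1 (fun e => nz (esym e)); have := vle_vdim h2 => d1 d2.
by rewrite IH ?subrr //; lia.
Qed.

End Unique.

Definition conv f g : V -> V -> laurent := fun w v => \sum_(z <- vint w v) f w z * g z v.

Section IntervalMatrices.
Variables (s : seq V) (w0 v0 : V).
Hypothesis s_vint : s = vint w0 v0.
Local Notation n := (size s).
Local Notation nths i := (nth w0 s i).

Definition imx f : 'M[laurent]_n :=
  \matrix_(i, j) (if `[< vle (nths i) (nths j) >] then f (nths i) (nths j) else 0).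

Lemma imx_conv f g : imx f *m imx g = imx (conv f g).
Proof.
apply/matrixP => i j; rewrite !mxE.
pose F z := (if `[< vle (nths i) z >] then f (nths i) z else 0)
            * (if `[< vle z (nths j) >] then g z (nths j) else 0).
transitivity (\sum_(z <- s) F z).
  by rewrite (big_nth w0) big_mkord; apply: eq_bigr => k _; rewrite !mxE.
have hi : vle w0 (nths i) by have /mem_vint[] : nths i \in vint w0 v0 by rewrite -s_vint mem_nth.
have hj : vle (nths j) v0 by have /mem_vint[] : nths j \in vint w0 v0 by rewrite -s_vint mem_nth.
case: asboolP => [hij|nij]; last first.
  rewrite big1 // => z _; rewrite /F; case: asboolP => h1; last by rewrite mul0r.
  case: asboolP => h2; last by rewrite mulr0.
  by case: nij; apply: vle_trans h1 h2.
transitivity (\sum_(z <- vint (nths i) (nths j)) F z).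
  apply: sum_supp; rewrite ?s_vint ?vint_uniq // => z.
  rewrite /F; case: asboolP => h1; last by rewrite mul0r eqxx.
  case: asboolP => h2; last by rewrite mulr0 eqxx.
  move=> _; apply/andP; split; [rewrite s_vint|]; apply/mem_vint; split=> //.
    exact: vle_trans h1.
  exact: vle_trans h2 hj.
rewrite /conv big_seq [RHS]big_seq; apply: eq_bigr => z /mem_vint[h1 h2].
by rewrite /F !asboolT.
Qed.

Lemma imx_eq f g : (forall w v, vle w v -> f w v = g w v) -> imx f = imx g.
Proof. by move=> h; apply/matrixP => i j; rewrite !mxE; case: asboolP => // /h. Qed.

Lemma imx1 : imx (fun w v => (w == v)%:R) = 1%:M.
Proof.
apply/matrixP => i j; rewrite !mxE nth_uniq ?s_vint ?vint_uniq -?s_vint // -[in RHS]val_eqE.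
case: (eqVneq (i : nat) j) => [->|_]; last by case: ifP.
by rewrite asboolT //; apply: vle_refl.
Qed.

Lemma imx_inj f g w v : w \in s -> v \in s -> vle w v -> imx f = imx g -> f w v = g w v.
Proof.
move=> ws vs h; pose i := Ordinal (eq_ind_r is_true ws (index_mem w s)).
pose j := Ordinal (eq_ind_r is_true vs (index_mem v s)).
by move=> /matrixP/(_ i j); rewrite !mxE /= !nth_index // asboolT.
Qed.

End IntervalMatrices.

Definition barf f : V -> V -> laurent := fun w v => bar (f w v).
Definition twist f : V -> V -> laurent := fun w v => sgn (vdim v - vdim w) * f w v.

Lemma conv_bar f g w v : bar (conv f g w v) = conv (barf f) (barf g) w v.
Proof. by rewrite bar_sum; apply: eq_bigr => z _; rewrite barM. Qed.

Lemma conv_twist f g w v : twist (conv f g) w v = conv (twist f) (twist g) w v.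
Proof.
rewrite /twist mulr_sumr; apply: eq_bigr => z _.
by rewrite mulrACA -sgnD; congr (sgn _ * _); lia.
Qed.

(* If [g = b * bar g], [y = bar y * b] and [bar b] is the sign twist of [b], then
   [y * twist g] is bar-invariant and unitriangular with entries in u^-1 Z[u^-1]
   off the diagonal, so it is the identity. *)
Lemma KL_inverse (b g y x : V -> V -> laurent) w v :
  is_KL b g -> (forall v, y v v = 1) ->
  (forall w v, vle w v -> w <> v -> in_neg (y w v)) ->
  (forall w v, vle w v -> y w v = conv (barf y) b w v) ->
  (forall w v, twist b w v = bar (b w v)) ->
  (forall w v, vle w v -> conv (twist g) x w v = (w == v)%:R) ->
  vle w v -> y w v = x w v.
Proof.
move=> [g1 gn gs] y1 yn ys tb gx h.
pose s := vint w v; have es : s = vint w v by [].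
pose M := imx s w.
have Mc f1 f2 : M f1 *m M f2 = M (conv f1 f2) by apply: imx_conv es _ _.
have Me f1 f2 : (forall w v, vle w v -> f1 w v = f2 w v) -> M f1 = M f2 by apply: imx_eq.
have M1 : M (fun w v => (w == v)%:R) = 1%:M by apply: imx1 es.
have tt f : twist (twist f) = f.
  apply/funext => w'; apply/funext => v'.
  by rewrite /twist mulrA sgn_sq mul1r.
have e1 : M (twist g) *m M x = 1%:M by rewrite Mc -M1; apply: Me.
have e2 : M x *m M (twist g) = 1%:M by apply: mulmx1C.
have bG : M (twist g) = M (barf b) *m M (barf (twist g)).
  rewrite Mc; apply: Me => w' v' h'.
  rewrite /twist (gs w' v' h') -[\sum_(_ <- _) _]/(conv b (barf g) w' v').
  rewrite -/(twist (conv b (barf g)) w' v') conv_twist; apply: eq_bigr => z _.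
  by rewrite tb /barf /twist barM bar_sgn.
have gB : M g = M b *m M (barf g) by rewrite Mc; apply: Me.
have gB' : M (barf g) = M (barf b) *m M g.
  rewrite Mc; apply: Me => w' v' h'; rewrite {1}/barf (gs w' v' h') bar_sum.
  by apply: eq_bigr => z _; rewrite barM barK.
have gi : M g *m M (twist x) = 1%:M.
  rewrite Mc -M1; apply: Me => w' v' h'.
  have := conv_twist (twist g) x w' v'; rewrite tt => <-; rewrite /twist gx //.
  by case: eqP => [->|_]; rewrite ?subrr ?sgn0 ?mulr1 ?mulr0.
have bb : M b *m M (barf b) = 1%:M.
  rewrite -[LHS]mulmx1 -gi mulmxA -(mulmxA (M b)) -gB' -gB gi.
  by [].
have yB : M y = M (barf y) *m M b by rewrite Mc; apply: Me.
have Z : M (conv y (twist g)) = M (conv (barf y) (barf (twist g))).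
  by rewrite -!Mc yB bG mulmxA -(mulmxA _ (M b)) bb mulmx1.
have Z1 : M (conv y (twist g)) = 1%:M.
  rewrite -M1; apply/matrixP => i j; rewrite !mxE; case: asboolP => // hij.
  set w' := nth _ _ i in hij *; set v' := nth _ _ j in hij *.
  case: eqP => [e|ne].
    rewrite -e /conv (bigD1_seq w') ?vint_uniq ?vint_l //=; last exact: vle_refl.
    rewrite y1 /twist subrr sgn0 g1 !mul1r big_seq_cond big1 ?addr0 // => z.
    move=> /andP[/mem_vint[h1 h2] /eqP nz].
    by have := vle_vdim_lt h1 (fun e => nz (esym e)); have := vle_vdim h2; lia.
  apply: in_neg_bar_eq0.
    apply: in_neg_sum => z /mem_vint[h1 h2].
    case: (pselect (w' = z)) => [<-|nwz]; first by rewrite y1 mul1r; apply/in_neg_sgn/gn.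
    case: (pselect (z = v')) => [->|nzv].
      by rewrite /twist subrr sgn0 g1 !mulr1; apply: yn.
    by apply: in_negM; [apply: yn | apply/in_neg_sgn/gn].
  by rewrite conv_bar; move/matrixP: Z => /(_ i j); rewrite !mxE -/w' -/v' asboolT.
have yx : M y = M x by rewrite -[LHS]mulmx1 -e1 mulmxA Mc Z1 mul1mx.
apply: (imx_inj (s := s) (w0 := w)) yx => //; first exact: vint_l.
by apply/mem_vint; split=> //; apply: vle_refl.
Qed.

End DoubleCosets.

Theorem corollary2p5
  (S Sh : finType) (W Wh : groupType)
  (C : coxeter_system S W) (Ch : coxeter_system Sh Wh) (E : hat_extension C Ch)
  (r : seq S) (r_uniq : uniq r) (r_enum : forall s : S, s \in r)
  (b : Vtype C -> Vtype C -> laurent)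
  (c cinv : Vtype C -> Vtype C -> {poly int})
  (PA PA' : Wh -> Wh -> {poly int}) :
  is_btilde b -> is_vKL b c -> is_vKLinv c cinv ->
  is_twKL Ch (Aset E) PA -> is_twKL Ch (Acompl E) PA' ->
  forall w v : Vtype C,
    c w v = PA (phi E r w) (phi E r v) /\
    cinv w v = PA' (phi E r v) (phi E r w).
Proof.
move=> hb [c0 g1 gn gs] [cinv0 hinv] [R [p [hR [p1 pn ps] hP hP0]]].
move=> [R' [p' [hR' [p1' pn' ps'] hP' hP0']]].
have leE w v := phi_leA E r_uniq r_enum w v.
have RE := Q_b r_uniq r_enum (twR_A_Qrec hR) _ _ hb.
have RE' := Q_b r_uniq r_enum (twR_Ac_Qrec hR') _ _ hb.
have lE := lA_phi E r_uniq r_enum.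
have neq w v : w <> v -> phi E r w <> phi E r v by move=> h /(phi_inj r_uniq r_enum).
have hg : is_KL E r_uniq r_enum b (gamma c).
  by split=> // w v _; rewrite gs (sum_vinterval E r_uniq r_enum).
have hp : is_KL E r_uniq r_enum b (fun w v => p (phi E r w) (phi E r v)).
  split=> [v|w v h /neq|w v h]; [exact: p1|by apply: pn; apply/leE|].
  rewrite ps; last exact/leE.
  rewrite (sum_phi_vint (E := E) r_uniq r_enum (fun x => R _ x * bar (p x _))%R
    (w := w) (v := v)) //.
  by apply: eq_bigr => z _; rewrite RE.
have hq w v : vle w v -> p' (phi E r v) (phi E r w) =
    (u ^ (vdim w - vdim v) * psubst (u ^+ 2) (cinv w v))%R.
  move=> h; pose y w v := p' (phi E r v) (phi E r w).
  pose x w v := (u ^ (vdim w - vdim v) * psubst (u ^+ 2) (cinv w v))%R.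
  rewrite -/(y w v) -/(x w v); apply: (KL_inverse hg) h => {w v}.
  - by move=> v; apply: p1'.
  - move=> w v h nwv; apply: pn'; first by apply/twle_Ac/leE.
    by apply: neq; apply: nesym.
  - move=> w v h; rewrite /y ps'; last by apply/twle_Ac/leE.
    rewrite (sum_phi_vint (E := E) r_uniq r_enum (fun x => R' _ x * bar (p' x _))%R
      (w := w) (v := v)).
      by apply: eq_bigr => z _; rewrite RE' mulrC.
    by move=> z; split=> -[/twle_Ac h1 /twle_Ac h2]; split=> //; apply/twle_Ac.
  - move=> w v; have := Q_b r_uniq r_enum (Qrec_bar (twR_A_Qrec hR)) w v hb.
    rewrite RE !lE (_ : (_ - _ - _)%R = (vdim w - vdim v)%R) => [e|]; last by lia.
    rewrite /twist -{1}e mulrA -sgnD.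
    by rewrite (_ : (_ + _)%R = 0%R) ?sgn0 ?mul1r //; lia.
  move=> w v h; have := congr1 (psubst (u ^+ 2)%R) (hinv w v).
  rewrite (sum_vinterval E r_uniq r_enum) psubst_sum => /(congr1 ( *%R (u ^ (vdim w - vdim v))%R)).
  rewrite mulr_sumr => e.
  transitivity (u ^ (vdim w - vdim v) * psubst (u ^+ 2) ((w == v)%:R))%R; last first.
    case: eqP => [->|_]; last by rewrite psubst0 mulr0.
    by rewrite psubst1 mulr1 subrr expr0z.
  rewrite -e; apply: eq_bigr => z _.
  rewrite !psubstM psubst_sgn /twist /x /gamma.
  rewrite (_ : vdim w - vdim v = (vdim w - vdim z) + (vdim z - vdim v))%R; last by lia.
  by rewrite (u_exprzD (vdim w - vdim z)); ring.
move=> w v; case: (pselect (vle w v)) => [h|nh]; last first.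
  rewrite c0 // cinv0 // hP0 ?hP0' //; first by move=> /twle_Ac/leE.
  by move=> /leE.
have lew : twle Ch (Aset E) (phi E r w) (phi E r v) by apply/leE.
split; apply: psubst_u2_inj.
  rewrite -hP // -(KL_unique hg hp h) /gamma !lE mulrA -u_exprzD.
  by rewrite (_ : (_ + _)%R = 0%R) ?expr0z ?mul1r //; lia.
rewrite -hP'; last exact/twle_Ac.
rewrite hq // !twlen_AcE !lE mulrA -u_exprzD.
by rewrite (_ : (_ + _)%R = 0%R) ?expr0z ?mul1r //; lia.
Qed.
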